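(* Let $A=M_t(G)$, the incidence matrix corresponding to a $t$-connected ideal of a connected graph $G$, and let $B$ be the matrix corresponding to the minimal feasible solutions of the integer linear program $A^T\mathbf{x}\ge \mathbf 1$, $\mathbf{x}\in\{0,1\}^n$. Then for each $\alpha\in\mathbb{N}^n$, $\tau_\alpha(B)=\nu_\alpha(B)$ if and only if the matrix $A$ has one of the following forms: (1) $A=M_t(P_n)$, $n\ge t$. Here $M_t(P_n)$ is the incidence matrix corresponding to the $t$-connected ideal of the path graph, given by $(M_t(P_n))_{ij}=1$ if $j\le i\le j+t-1$ and $0$ otherwise, where $1\le i\le n$ and $1\le j\le n-t+1$. (2) $A=M_t(C_n)$ with $t=n$ or $(t,n)\in\{(3,6),(3,9),(4,8)\}$. Here $M_t(C_n)$ is the incidence matrix corresponding to the $t$-connected ideal of the cycle $C_n$, given by $(M_t(C_n))_{ij}=1$ if $0\le (i-j \pmod n)\le t-1$ and $0$ otherwise.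
   Context: Let $\mathbb K$ be a field and $G$ a simple graph with $V(G)=\{x_1,\dots,x_n\}$. For $t\ge2$, the $t$-connected ideal of $G$ is $I_t(G)=\langle x_{i_1}\cdots x_{i_t}: G[\{x_{i_1},\dots,x_{i_t}\}]\text{ is connected}\rangle\subseteq\mathbb{K}[x_1,\dots,x_n]$, the generators running over $t$-element vertex subsets, where $G[S]$ is the induced subgraph on $S$. The incidence matrix $M_t(G)$ is the $n\times m$ matrix with entries $0$ or $1$ whose columns $\mathbf a_1,\dots,\mathbf a_m\in\{0,1\}^n$ are the exponent vectors of the monomial generators of $I_t(G)$. A feasible solution $\mathbf x\in\{0,1\}^n$ of $A^T\mathbf x\ge\mathbf 1$ is minimal if for every nonzero $\mathbf w\in\{0,1\}^n$ with $\mathbf x-\mathbf w\in\{0,1\}^n$, the vector $\mathbf x-\mathbf w$ is not a feasible solution. Let $\{\mathbf b_1,\dots,\mathbf b_r\}$ be the set of all minimal feasible solutions; $B$ is the $n\times r$ matrix with columns $\mathbf b_1,\dots,\mathbf b_r$. For $\alpha\in\mathbb{N}^n$, $\tau_\alpha(B)$ is the optimal value of: minimize $\alpha\cdot\mathbf y$ subject to $B^T\mathbf y\ge\mathbf 1$, $\mathbf y\in\mathbb N^n$; and $\nu_\alpha(B)$ is the optimal value of: maximize $\mathbf z\cdot\mathbf 1$ subject to $B\mathbf z\le\alpha$, $\mathbf z\in\mathbb N^r$. Here $\mathbf 1$ is an all-ones vector and inequalities are entrywise. $P_n$ is the path on $n$ vertices (edges $x_ix_{i+1}$, $1\le i\le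 n-1$), and $C_n$ is the cycle on $n$ vertices (edges $x_ix_{i+1}$, $1\le i\le n-1$, and $x_1x_n$).
   Formalization: The theorem is stated for t ≥ 3 instead of t ≥ 2, since for t = 2 the equivalence fails (e.g. for the star K_{1,3}, where τ_α(B)=ν_α(B) for all α); A ''has the form'' is read up to relabelling vertices and reordering columns. *)

(* Defs.v *)
(* MathComp development. *)
From mathcomp Require Import all_boot all_order all_fingroup all_algebra.

Set Implicit Arguments.
Unset Strict Implicit.
Unset Printing Implicit Defensive.

Local Open Scope ring_scope.

(* A graph with vertices x_1, ..., x_n is an adjacency relation on 'I_n, the
   vertex x_(i+1) being the ordinal i.  All rows and columns below are thus
   indexed from 0. *)

Section TConnected.

Variables (n : nat) (e : rel 'I_n).

Definition induced_rel (S : {set 'I_n}) : rel 'I_n :=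
  [rel u v | [&& u \in S, v \in S & e u v]].

Definition induced_connected (S : {set 'I_n}) : bool :=
  [forall u in S, forall v in S, connect (induced_rel S) u v].

Definition connected_graph : bool := induced_connected [set: 'I_n].

(* S stands for the squarefree monomial generator \prod_(i in S) x_i of
   I_t(G), whose exponent vector is the indicator vector of S. *)
Definition connected_tsets (t : nat) : {set {set 'I_n}} :=
  [set S : {set 'I_n} | (#|S| == t) && induced_connected S].

Definition tconn_mx (t : nat) : 'M[nat]_(n, #|connected_tsets t|) :=
  \matrix_(i, j) ((i \in (enum_val j : {set 'I_n})) : nat).

End TConnected.

Definition path_graph (n : nat) : rel 'I_n :=
  [rel i j : 'I_n | (i.+1 == j :> nat) || (j.+1 == i :> nat)].

(* Only meant for 3 <= n. *)
Definition cycle_graph (n : nat) : rel 'I_n :=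
  [rel i j : 'I_n | [|| path_graph i j,
                        (i == 0%N :> nat) && (j.+1 == n) |
                        (j == 0%N :> nat) && (i.+1 == n)]].

Definition path_mx (t n : nat) : 'M[nat]_(n, (n - t).+1) :=
  \matrix_(i, j) ((j <= i < j + t)%N : nat).

(* (i + n - j) %% n is the residue of i - j in {0, ..., n-1}.  When t = n all
   the cyclic windows are the whole vertex set, so that I_n(C_n) has a single
   generator; there are n distinct windows when t < n. *)
Definition cycle_mx (t n : nat) : 'M[nat]_(n, if (t < n)%N then n else 1%N) :=
  \matrix_(i, j) (((i + n - j) %% n < t)%N : nat).

Definition eq_up_to_columns n m p (A : 'M[nat]_(n, m)) (B : 'M[nat]_(n, p)) :=
  exists2 s : 'I_m -> 'I_p, bijective s & forall i j, A i j = B i (s j).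

(* Equality up to relabelling the vertices (rows) and reordering the monomial
   generators (columns). *)
Definition eq_up_to_relabelling n m p
    (A : 'M[nat]_(n, m)) (B : 'M[nat]_(n, p)) :=
  exists r : 'S_n, eq_up_to_columns (row_perm r A) B.

Definition ones (m : nat) : 'cV[nat]_m := const_mx 1%N.

Definition le_entrywise m (u v : 'cV[nat]_m) : bool :=
  [forall i, (u i ord0 <= v i ord0)%N].

Definition dot m (u v : 'cV[nat]_m) : nat := (u^T *m v) 0 0.

(* {0,1}^n is 'cV[bool]_n, a finite type, embedded in N^n by vec01. *)
Definition vec01 n (x : 'cV[bool]_n) : 'cV[nat]_n := map_mx nat_of_bool x.

Section MinimalSolutions.

Variables (n m : nat) (A : 'M[nat]_(n, m)).

Definition feasible (x : 'cV[bool]_n) : bool :=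
  le_entrywise (ones m) (A^T *m vec01 x).

(* y is x - w, the subtraction being taken over the integers. *)
Definition minimal_feasible (x : 'cV[bool]_n) : bool :=
  feasible x &&
  [forall w : 'cV[bool]_n, forall y : 'cV[bool]_n,
     (vec01 w != 0) && (vec01 x == vec01 y + vec01 w) ==> ~~ feasible y].

Definition min_solutions : {set 'cV[bool]_n} := [set x | minimal_feasible x].

Definition min_solutions_mx : 'M[nat]_(n, #|min_solutions|) :=
  \matrix_(i, j) vec01 (enum_val j) i 0.

End MinimalSolutions.

Section OptimalValues.

Variables (n r : nat) (B : 'M[nat]_(n, r)) (alpha : 'cV[nat]_n).

Definition tau_feasible (y : 'cV[nat]_n) : bool :=
  le_entrywise (ones r) (B^T *m y).

Definition nu_feasible (z : 'cV[nat]_r) : bool :=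
  le_entrywise (B *m z) alpha.

Definition is_tau (v : nat) : Prop :=
  (exists2 y, tau_feasible y & dot alpha y = v) /\
  (forall y, tau_feasible y -> (v <= dot alpha y)%N).

Definition is_nu (v : nat) : Prop :=
  (exists2 z, nu_feasible z & dot z (ones r) = v) /\
  (forall z, nu_feasible z -> (dot z (ones r) <= v)%N).

(* Both programs attain their optimum, and the optimal values agree. *)
Definition tau_eq_nu : Prop := exists2 v, is_tau v & is_nu v.

End OptimalValues.

(* Main.v *)
Require Import Defs.
From mathcomp Require Import all_boot all_order all_fingroup all_algebra.
From mathcomp Require Import zify.

(* The columns of B are the minimal transversals of the hypergraph of connected
   t-sets, so tau_alpha(B) is the least alpha-weight of a connected t-set and
   nu_alpha(B) is the largest packing of transversals under the load alpha.

   Necessity. For alpha = 1, a connected set of t + 1 vertices with three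
   non-cut vertices bounds the packing strictly below t; a vertex of degree
   three lies in such a set as soon as t < n, so G is a path or a cycle. On a
   cycle, transversals of the n windows have at least n / t elements, and
   alpha = 1 forces n = k t. A transversal with exactly k elements is then a
   residue class mod t, so a 0/1 vector alpha vanishing somewhere on each class,
   with two elements in each window and at most 2 k + 1 ones, gives
   tau >= 2 > nu. Such a vector exists unless (t, n) is (3, 6), (3, 9) or
   (4, 8).

   Sufficiency. On a line, a weighted colouring of consecutive tokens modulo tau
   yields the packing. In the three exceptional cycles, either a residue class
   lies in the support of alpha and is removed, or some window meets the support
   in at most one vertex, and the cycle can be cut open there. *)

Set Implicit Arguments.
Unset Strict Implicit.
Unset Printing Implicit Defensive.

(** * Transversals and the two integer programs *)

Definition hitting n (E : {set {set 'I_n}}) (T : {set 'I_n}) : bool :=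
  [forall S in E, T :&: S != set0].

(** Unfolds to the same matrix as [tconn_mx e t] when [E] is [connected_tsets e t]; an arbitrary
    family [E] also covers relabelled graphs. *)
Definition incidence_mx n (E : {set {set 'I_n}}) : 'M[nat]_(n, #|E|) :=
  (\matrix_(i, j) (i \in (enum_val j : {set 'I_n}) : nat))%R.

(** Preimages, because [row_perm r] puts row [r i] of a matrix at row [i]. *)
Definition relabel n (r : 'S_n) (E : {set {set 'I_n}}) : {set {set 'I_n}} :=
  [set r @^-1: S | S : {set 'I_n} in E].

Definition support n (x : 'cV[bool]_n) : {set 'I_n} := [set i | x i 0%R].

Lemma hittingP n (E : {set {set 'I_n}}) (T : {set 'I_n}) :
  reflect (forall S, S \in E -> exists2 i, i \in T & i \in S)
          (hitting E T).
Proof.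
apply: (iffP forall_inP) => hT S SE.
  by have /set0Pn[i /setIP[iT iS]] := hT S SE; exists i.
by have [i iT iS] := hT S SE; apply/set0Pn; exists i; rewrite inE iT.
Qed.

Lemma dotE n (u v : 'cV[nat]_n) : dot u v = \sum_i u i 0%R * v i 0%R.
Proof. by rewrite /dot mxE; apply: eq_bigr => i _; rewrite mxE. Qed.

Lemma tr_mul_colE n m (B : 'M[nat]_(n, m)) (y : 'cV[nat]_n) j :
  (B^T *m y)%R j 0%R = \sum_i B i j * y i 0%R.
Proof. by rewrite mxE; apply: eq_bigr => i _; rewrite mxE. Qed.

Lemma feasibleE n (E : {set {set 'I_n}}) x :
  feasible (incidence_mx E) x = hitting E (support x).
Proof.
have sumE j : ((incidence_mx E)^T *m vec01 x)%R j 0%R =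
    \sum_(i in enum_val j) (x i 0%R : nat).
  rewrite tr_mul_colE [RHS]big_mkcond /=; apply: eq_bigr => i _.
  by rewrite !mxE; case: ifP => _; rewrite ?mul1n ?mul0n.
apply/forallP/hittingP => h.
  move=> S SE; move: (h (enum_rank_in SE S)); rewrite sumE mxE enum_rankK_in //.
  rewrite lt0n sum_nat_eq0 negb_forall => /existsP[i].
  by rewrite negb_imply eqb0 negbK => /andP[iS xi]; exists i; rewrite ?inE.
move=> j; rewrite sumE mxE; have [i] := h _ (enum_valP j).
rewrite inE => xi ij; rewrite (bigD1 i) //= xi; lia.
Qed.

Lemma min_solution_hitting n (E : {set {set 'I_n}}) x :
  x \in min_solutions (incidence_mx E) -> hitting E (support x).
Proof. by rewrite inE => /andP[]; rewrite feasibleE. Qed.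

(** Writing [x = y + w] with [w] nonzero strictly shrinks the support, so an inclusion-minimal
    transversal is the support of a minimal solution. *)
Lemma min_solution_below n (E : {set {set 'I_n}}) T :
  hitting E T ->
  exists2 x, x \in min_solutions (incidence_mx E) & support x \subset T.
Proof.
move=> /minset_exists[U minU sUT].
pose x : 'cV[bool]_n := (\col_i (i \in U))%R.
have sx : support x = U by apply/setP => i; rewrite inE mxE.
exists x; last by rewrite sx.
rewrite inE /minimal_feasible feasibleE sx (minsetp minU) /=.
apply/forallP => w; apply/forallP => y; apply/implyP => /andP[w0 /eqP xyw].
apply: contra w0; rewrite feasibleE => hy.
have xE i : (i \in U : nat) = y i 0%R + w i 0%R.
  have := congr1 (fun M : 'cV[nat]_n => M i 0%R) xyw.
  by rewrite /vec01 !mxE.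
have yU : support y = U.
  apply: (minsetinf minU) => //; apply/subsetP => i; rewrite inE => yi.
  by have := xE i; rewrite yi; case: (i \in U).
apply/eqP/matrixP => i j; rewrite (ord1 j) !mxE.
have := xE i; rewrite -yU inE; case: (y i _) => /=; lia.
Qed.

Lemma min_solutions_mxE n (E : {set {set 'I_n}}) i j :
  min_solutions_mx (incidence_mx E) i j = (i \in support (enum_val j)).
Proof. by rewrite !mxE inE. Qed.

(** Blocking duality: if the support of [y] contained no member of [E], the zero set of [y] would be
    a transversal, and a minimal one inside it would give a constraint on which [y] sums to 0. *)
Lemma tau_feasibleP n (E : {set {set 'I_n}}) (y : 'cV[nat]_n) :
  reflect (exists2 S, S \in E & forall i, i \in S -> 0 < y i 0%R)
          (tau_feasible (min_solutions_mx (incidence_mx E)) y).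
Proof.
have sumE j : ((min_solutions_mx (incidence_mx E))^T *m y)%R j 0%R =
    \sum_(i in support (enum_val j)) y i 0%R.
  rewrite tr_mul_colE [RHS]big_mkcond /=; apply: eq_bigr => i _.
  by rewrite min_solutions_mxE; case: ifP => _; rewrite ?mul1n ?mul0n.
apply: (iffP forallP) => [h | [S SE hS] j].
  have [/existsP[S /andP[SE /forall_inP hS]] | /existsPn noS] :=
    boolP [exists S, (S \in E) && [forall i in S, 0 < y i 0%R]].
    by exists S.
  have /min_solution_below[x xmin /subsetP sx] :
      hitting E [set i | y i 0%R == 0].
    apply/hittingP => S SE; have := noS S; rewrite SE /=.
    rewrite negb_forall => /existsP[i]; rewrite negb_imply -leqNgt leqn0.
    by case/andP=> iS yi; exists i; rewrite ?inE.
  have := h (enum_rank_in xmin x); rewrite sumE enum_rankK_in // mxE big1 //.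
  by move=> i /sx; rewrite inE => /eqP.
rewrite sumE mxE; have /hittingP/(_ S SE)[i ij iS] :=
  min_solution_hitting (enum_valP j).
by rewrite (bigD1 i) //=; have := hS _ iS; lia.
Qed.

Lemma nu_feasibleE n (E : {set {set 'I_n}}) (alpha : 'cV[nat]_n) z :
  nu_feasible (min_solutions_mx (incidence_mx E)) alpha z =
  [forall i, \sum_j (i \in support (enum_val j)) * z j 0%R <= alpha i 0%R].
Proof.
apply: eq_forallb => i; rewrite mxE; congr (_ <= _).
by apply: eq_bigr => j _; rewrite min_solutions_mxE.
Qed.

Lemma sum_packing n r (b : 'I_r -> {set 'I_n}) (z : 'I_r -> nat)
    (u : 'I_n -> nat) :
  \sum_i u i * (\sum_j (i \in b j) * z j) =
  \sum_j z j * \sum_(i in b j) u i.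
Proof.
under eq_bigr => i _ do rewrite big_distrr /=.
rewrite exchange_big; apply: eq_bigr => j _.
rewrite [in RHS]big_mkcond big_distrr /=; apply: eq_bigr => i _.
by case: (i \in b j); rewrite ?mul1n ?mul0n ?muln0 // mulnC.
Qed.

(* Weak duality for the packing program, with the dual solution u / c, against
   the optimum of the covering program. *)
Lemma dual_bound n (E : {set {set 'I_n}}) (a u : 'I_n -> nat) (l c : nat) :
  tau_eq_nu (min_solutions_mx (incidence_mx E)) (\col_i a i)%R ->
  (forall S, S \in E -> l <= \sum_(i in S) a i) ->
  (forall T, hitting E T -> (forall i, i \in T -> 0 < a i) ->
     c <= \sum_(i in T) u i) ->
  l * c <= \sum_i a i * u i.
Proof.
case=> v [[y /tau_feasibleP[S SE yS] <-] _] [[z]].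
rewrite nu_feasibleE => /forallP hz zv _ hl hc.
have lev : l <= dot (\col_i a i)%R y.
  rewrite dotE (leq_trans (hl S SE)) // [X in X <= _]big_mkcond.
  apply: leq_sum => i _; rewrite mxE; case: ifP => // /yS y0.
  exact: leq_pmulr.
apply: (leq_trans (leq_mul lev (leqnn c))); rewrite -zv dotE big_distrl /=.
under [X in _ <= X]eq_bigr => i _ do rewrite mulnC.
have ha i : \sum_j (i \in support (enum_val j)) * z j 0%R <= a i.
  by have := hz i; rewrite mxE.
apply: (@leq_trans (\sum_i u i *
  \sum_j (i \in support (enum_val j)) * z j 0%R)); last first.
  by apply: leq_sum => i _; rewrite leq_mul.
rewrite sum_packing; apply: leq_sum => j _; rewrite mxE muln1.
have [->//|z0] := posnP (z j 0%R); rewrite leq_mul // hc //.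
  exact: (min_solution_hitting (enum_valP j)).
move=> i ij; apply: leq_trans (ha i); rewrite (bigD1 j) //= ij mul1n.
exact: leq_trans z0 (leq_addr _ _).
Qed.

Definition packs n (E : {set {set 'I_n}}) (a : 'I_n -> nat) (v : nat) : Prop :=
  exists2 T : 'I_v -> {set 'I_n}, forall k, hitting E (T k) &
    forall i, \sum_k (i \in T k) <= a i.

(** With [v] the least weight of a member of [E], shrinking the packed transversals to minimal ones
    and recording multiplicities gives a [z] of value [v]; no packing does better, since every
    transversal meets the lightest member. *)
Lemma tau_eq_nu_packs n (E : {set {set 'I_n}}) (alpha : 'cV[nat]_n) :
  E != set0 ->
  (forall v, (forall S, S \in E -> v <= \sum_(i in S) alpha i 0%R) ->
     packs E (fun i => alpha i 0%R) v) ->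
  tau_eq_nu (min_solutions_mx (incidence_mx E)) alpha.
Proof.
move=> /set0Pn[S0 S0E] hp.
pose w (S : {set 'I_n}) := \sum_(i in S) alpha i 0%R.
have [S SE minS] : exists2 S, S \in E & forall S', S' \in E -> w S <= w S'.
  by case: (arg_minnP w S0E) => S SE h; exists S.
have [T trT loadT] := hp _ minS.
have /fin_all_exists2 [x xmin xT] k := min_solution_below (trT k).
exists (w S).
  split.
    exists (\col_i (i \in S : nat))%R.
      by apply/tau_feasibleP; exists S => // i iS; rewrite mxE iS.
    rewrite dotE /w [RHS]big_mkcond; apply: eq_bigr => i _.
    by rewrite mxE; case: (i \in S); rewrite ?muln1 ?muln0.
  move=> y /tau_feasibleP[S' S'E hy]; apply: leq_trans (minS _ S'E) _.
  rewrite dotE /w [X in X <= _]big_mkcond; apply: leq_sum => i _.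
  by case: ifP => // /hy; exact: leq_pmulr.
split.
  pose z : 'cV[nat]_#|min_solutions (incidence_mx E)| :=
    (\col_j (\sum_k (enum_val j == x k))%N)%R.
  have zE (g : 'cV[bool]_n -> nat) : \sum_j g (enum_val j) * z j 0%R = \sum_k g (x k).
    under eq_bigr => j _ do rewrite mxE big_distrr /=.
    rewrite exchange_big; apply: eq_bigr => k _ /=.
    rewrite (bigD1 (enum_rank_in (xmin k) (x k))) //= enum_rankK_in // eqxx muln1.
    rewrite big1 ?addn0 // => j /eqP hj; case: eqP => [E0|]; last by rewrite muln0.
    by case: hj; apply: enum_val_inj; rewrite enum_rankK_in.
  exists z.
    rewrite nu_feasibleE; apply/forallP => i.
    rewrite (zE (fun b => i \in support b)); apply: leq_trans (loadT i).
    by apply: leq_sum => k _; case: (boolP (i \in _)) => // /(subsetP (xT k)) ->.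
  rewrite dotE; under eq_bigr => j _ do rewrite [X in _ * X]mxE mulnC.
  by rewrite (zE (fun=> 1)) sum1_card card_ord.
move=> z; rewrite nu_feasibleE => /forallP hz.
apply: (@leq_trans (\sum_i (i \in S) *
  \sum_j (i \in support (enum_val j)) * z j 0%R)); last first.
  rewrite /w [X in _ <= X]big_mkcond; apply: leq_sum => i _.
  by case: (i \in S); rewrite ?mul1n.
rewrite sum_packing dotE; apply: leq_sum => j _; rewrite mxE leq_mul //.
have /hittingP/(_ S SE)[i ij iS] := min_solution_hitting (enum_valP j).
by rewrite (bigD1 i) //= iS.
Qed.

(** * Packings of transversals *)

Lemma packs_perm n (r : 'S_n) (E E' : {set {set 'I_n}}) a v :
  (forall S, S \in E -> r @^-1: S \in E') ->
  packs E' (fun i => a (r i)) v -> packs E a v.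
Proof.
move=> EE' [T trT loadT]; exists (fun k => [set i | r^-1%g i \in T k]) => [k|i].
  apply/hittingP => S /EE' S'E; have /hittingP/(_ _ S'E)[i iT] := trT k.
  by rewrite inE => iS; exists (r i); rewrite // inE permK.
have := loadT (r^-1%g i); rewrite permKV; congr (_ <= _).
by apply: eq_bigr => k _; rewrite inE.
Qed.

Lemma residue_hit m v k : k < v -> exists2 p, m <= p < m + v & p %% v = k.
Proof.
move=> kv; have v0 : 0 < v by case: v kv.
have [le_mk | lt_km] := leqP (m %% v) k.
  exists (m %/ v * v + k); last by rewrite modnMDl modn_small.
  have := divn_eq m v; lia.
exists ((m %/ v).+1 * v + k); last by rewrite modnMDl modn_small.
by have := divn_eq m v; have := ltn_pmod m v0; rewrite mulSn; lia.
Qed.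

Lemma step_through (P : nat -> nat) lo hi p :
  lo <= hi -> P lo <= p < P hi -> exists2 i, lo <= i < hi & P i <= p < P i.+1.
Proof.
move=> /subnKC <-; elim: (hi - lo) => [|d IHd]; first by rewrite addn0; lia.
move=> hp; have [hd|hd] := ltnP p (P (lo + d)).
  have [|i hi1 hi2] := IHd; first by rewrite hd andbT; case/andP: hp.
  by exists i => //; lia.
exists (lo + d); first lia.
by rewrite hd -addnS; case/andP: hp.
Qed.

(* Replace i by a i consecutive tokens and colour all tokens cyclically with v
   colours: v consecutive tokens show every colour, so that each colour class
   meets every member of E. *)
Lemma packs_intervals n (E : {set {set 'I_n}}) (a : 'I_n -> nat) v :
  (forall S, S \in E -> exists lo hi,
     (forall i : 'I_n, lo <= i < hi -> i \in S) /\
     v <= \sum_(i < n | lo <= i < hi) a i) ->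
  packs E a v.
Proof.
(* [P m] counts the tokens before vertex [m], so vertex [i] owns the tokens from [P i] up to
   [P i.+1], excluded. *)
move=> hE; pose P m := \sum_(i < n | i < m) a i.
have PS (i : 'I_n) : P i.+1 = P i + a i.
  rewrite /P (bigD1 i) //= addnC; congr (_ + _); apply: eq_bigl => j.
  by rewrite -val_eqE /=; lia.
exists (fun k : 'I_v => [set i | [exists p : 'I_(a i), (P i + p) %% v == k]]).
  move=> k; apply/hittingP => S /hE[lo [hi [hS hv]]].
  have Phi : P lo + v <= P hi.
    have [le_lh|lt_hl] := leqP lo hi; last first.
      move: hv; rewrite big1 => [|i]; last by lia.
      by have := ltn_ord k; lia.
    apply: (leq_trans (n := P lo + \sum_(i < n | lo <= i < hi) a i)).
      by rewrite leq_add2l.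
    rewrite /P [X in _ <= X](bigID (fun i : 'I_n => i < lo)) /=.
    apply/eq_leq; congr (_ + _); apply: eq_bigl => j; lia.
  (* The interval owns at least [v] consecutive tokens, hence one of colour [k]; its owner is the
     common vertex. *)
  have [p hp pk] := residue_hit (P lo) (ltn_ord k).
  have lt_lh : lo <= hi.
    rewrite leqNgt; apply/negP => lt_hl.
    have : P hi <= P lo.
      rewrite /P [X in _ <= X](bigID (fun i : 'I_n => i < hi)) /=.
      rewrite (eq_bigl (fun i : 'I_n => (i < lo) && (i < hi))) ?leq_addr //.
      by move=> j; lia.
    by have := ltn_ord k; lia.
  have [|i hi1 hi2] := @step_through P lo hi p lt_lh; first lia.
  have i_n : i < n.
    rewrite ltnNge; apply/negP => le_ni.
    suff : P i.+1 = P i by lia.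
    by apply: eq_bigl => j; have := ltn_ord j; lia.
  exists (Ordinal i_n); last exact: hS.
  have := PS (Ordinal i_n) => /= PSi.
  have pa : p - P i < a (Ordinal i_n) by lia.
  rewrite inE; apply/existsP; exists (Ordinal pa) => /=.
  by rewrite subnKC ?pk; lia.
move=> i; apply: (@leq_trans (\sum_(k < v) \sum_(p < a i) ((P i + p) %% v == k))).
  apply: leq_sum => k _; rewrite inE.
  case: (boolP [exists _, _]) => // /existsP[p hp].
  by rewrite (bigD1 p) //= hp.
rewrite exchange_big /= -[X in _ <= X]card_ord -sum1_card.
apply: leq_sum => p _; have [->|v0] := posnP v; first by rewrite big_ord0.
rewrite (bigD1 (Ordinal (ltn_pmod (P i + p) v0))) //= eqxx big1 // => k.
by rewrite -val_eqE eq_sym /= => /negbTE ->.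
Qed.

(** * Packings in the three exceptional cycles *)

Definition window n t s : {set 'I_n} := [set i : 'I_n | (i + n - s) %% n < t].

Definition windows n t : {set {set 'I_n}} := [set window n t s | s : 'I_n].

Lemma offsetE n i s : i < n -> s < n ->
  (i + n - s) %% n = if s <= i then i - s else i + n - s.
Proof.
move=> lt_in lt_sn; case: leqP => h.
  have -> : i + n - s = n + (i - s) by lia.
  by rewrite modnDl modn_small //; lia.
by rewrite modn_small //; lia.
Qed.

Lemma in_window n t s (i : 'I_n) : s < n ->
  (i \in window n t s) = ((if s <= i then i - s else i + n - s) < t).
Proof. by move=> lt_sn; rewrite inE offsetE. Qed.

Definition residue_class n t r : {set 'I_n} := [set i : 'I_n | i %% t == r].

Lemma window_offset n t s (i : 'I_n) : s < n -> i \in window n t s ->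
  exists2 o, o < t & i = (if s + o < n then s + o else s + o - n) :> nat.
Proof.
move=> lt_sn; rewrite in_window // => iw.
exists (if s <= i then i - s else i + n - s) => //.
by have := ltn_ord i; do 2 case: ifP; lia.
Qed.

Lemma offset_window n t s o : s < n -> t <= n -> o < t ->
  exists2 i : 'I_n, i \in window n t s &
    i = (if s + o < n then s + o else s + o - n) :> nat.
Proof.
move=> lt_sn le_tn lt_ot.
have lt_in : (if s + o < n then s + o else s + o - n) < n by case: ifP; lia.
by exists (Ordinal lt_in); rewrite // in_window //=; do 2 case: ifP; lia.
Qed.

Lemma modn_wrap n t m : t %| n -> (if m < n then m else m - n) = m %[mod t].
Proof.
move=> tn; case: ltnP => // le_nm.
by rewrite -[in RHS](subnK le_nm) -modnDmr (eqP tn) addn0.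
Qed.

(** As [t] divides [n], wrapping around preserves residues modulo [t], so the [t] consecutive
    vertices of a window show each residue exactly once. *)
Lemma card_window_class n t s r : t %| n -> r < t -> s < n ->
  \sum_(i in window n t s) (i \in residue_class n t r) = 1.
Proof.
move=> tn lt_rt lt_sn; have n0 : 0 < n by apply: leq_ltn_trans lt_sn.
have le_tn : t <= n by apply: dvdn_leq.
have t0 : 0 < t by apply: leq_ltn_trans lt_rt.
have [o lt_ot so] : exists2 o, o < t & (s + o) %% t = r.
  exists ((r + t - s %% t) %% t); first by rewrite ltn_pmod.
  rewrite modnDmr -modnDml subnKC; first by rewrite modnDr modn_small.
  exact: leq_trans (ltnW (ltn_pmod s t0)) (leq_addl _ _).
have [i0 i0w i0E] := offset_window lt_sn le_tn lt_ot.
have i0c : i0 \in residue_class n t r by rewrite inE i0E modn_wrap // so.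
rewrite (bigD1 i0) //= i0c big1 // => i /andP[iw ii0].
apply/eqP; rewrite eqb0; apply: contra ii0; rewrite inE => /eqP.
have [o' lt_o't iE] := window_offset lt_sn iw.
rewrite iE modn_wrap // -so => /eqP; rewrite eqn_modDl !modn_small // => /eqP oo'.
by rewrite -val_eqE /= iE i0E oo'.
Qed.

Fixpoint all_bits m : seq bitseq :=
  if m is m'.+1 then
    let l := all_bits m' in map (cons true) l ++ map (cons false) l
  else [:: [::]].

Lemma mem_all_bits (w : bitseq) : w \in all_bits (size w).
Proof.
elim: w => // b w IHw /=; rewrite mem_cat; case: b; rewrite map_f //.
by rewrite orbT.
Qed.

(** A computable form, on the 0/1 word of a support, of the dichotomy: the support contains a
    residue class, or some window meets it at most in one position [x]. *)
Definition class_or_singleton t n (w : bitseq) : bool :=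
  has (fun r => all (fun i => (i %% t == r) ==> nth false w i) (iota 0 n))
    (iota 0 t)
  || has (fun s => has (fun x => all (fun i =>
       ((i + n - s) %% n < t) && nth false w i ==> (i == x))
       (iota 0 n)) (iota 0 n)) (iota 0 n).

Lemma class_or_singleton_exceptional t n w :
  (t, n) \in [:: (3, 6); (3, 9); (4, 8)] -> size w = n ->
  class_or_singleton t n w.
Proof.
move=> tn wn; have wb : w \in all_bits n by rewrite -wn mem_all_bits.
suff /allP/(_ w wb) : all (class_or_singleton t n) (all_bits n) by [].
(* Exhaustive check of the 64, 512 and 256 words of length 6, 9 and 8. *)
move: tn; rewrite !inE => /or3P[] /eqP[-> ->].
- by vm_compute.
- by vm_compute.
by vm_compute.
Qed.

Lemma window_center n t (b : pred 'I_n) :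
  (t, n) \in [:: (3, 6); (3, 9); (4, 8)] ->
  (exists2 r, r < t & forall i, i \in residue_class n t r -> b i) \/
  (exists (s : 'I_n) (x : 'I_n),
     forall i, i \in window n t s -> b i -> i = x).
Proof.
move=> tn; pose w := [seq b i | i <- enum 'I_n].
have sw : size w = n by rewrite size_map size_enum_ord.
have nw (i : 'I_n) : nth false w i = b i.
  rewrite (nth_map i) ?size_enum_ord //; congr b; apply: val_inj.
  by rewrite /= nth_enum_ord.
have in_iota (i : 'I_n) : (i : nat) \in iota 0 n by rewrite mem_iota ltn_ord.
case/orP: (class_or_singleton_exceptional tn sw) => /hasP[r].
  rewrite mem_iota /= => lt_rt /allP h; left; exists r => // i.
  by rewrite inE -nw => ir; have := h i (in_iota i); rewrite ir.
rewrite mem_iota /= => lt_rn /hasP[x]; rewrite mem_iota /= => lt_xn /allP h.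
right; exists (Ordinal lt_rn), (Ordinal lt_xn) => i; rewrite inE /= => ir bi.
by apply/val_inj/eqP; have := h i (in_iota i); rewrite ir nw bi.
Qed.

Lemma packsS n (E : {set {set 'I_n}}) (a : 'I_n -> nat) T v :
  hitting E T -> (forall i, i \in T -> 0 < a i) ->
  packs E (fun i => a i - (i \in T)) v -> packs E a v.+1.
Proof.
move=> trT Ta [U trU loadU].
exists (fun k : 'I_v.+1 => oapp U T (unlift ord0 k)) => [k|i].
  by case: unliftP => [j|] _ /=.
rewrite big_ord_recl unlift_none /= (eq_bigr (fun k => i \in U k : nat)).
  apply: leq_trans (leq_add (leqnn _) (loadU i)) _.
  by case: (boolP (i \in T)) => [/Ta|_]; lia.
by move=> k _; rewrite liftK.
Qed.

(** Cut the cycle at [x]: windows avoiding [x] become intervals of a line, and in a window through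
    [x] the single vertex [x], of weight at least [v], serves as the interval. *)
Lemma packs_window_center n t (a : 'I_n -> nat) v (x : 'I_n) :
  t < n -> v <= a x ->
  (forall s : 'I_n, v <= \sum_(i in window n t s) a i) ->
  packs (windows n t) a v.
Proof.
move=> lt_tn vx hv; have n0 : 0 < n by apply: leq_ltn_trans lt_tn.
(* The rotation sends 0 to [x]; pulling back along it puts [x] at the start of the line. *)
pose rot (i : 'I_n) := Ordinal (ltn_pmod (i + x) n0).
have rotE i : rot i = (if i + x < n then i + x else i + x - n) :> nat.
  rewrite /=; case: ltnP => h; first by rewrite modn_small.
  rewrite -{1}(subnK h) modnDr modn_small //.
  by have := ltn_ord i; have := ltn_ord x; lia.
have rot_inj : injective rot.
  move=> i j /(congr1 val) /=; rewrite -/(rot i) -/(rot j) => h; apply/val_inj.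
  have := rotE i; have := rotE j; rewrite /= h.
  by have := ltn_ord i; have := ltn_ord j; do 2 case: ifP => /=; lia.
apply: (@packs_perm _ (perm rot_inj) _
  (relabel (perm rot_inj) (windows n t))) ; first exact: imset_f.
apply: packs_intervals => _ /imsetP[_ /imsetP[s _ ->] ->].
have [xw | xw] := boolP (x \in window n t s).
  have rot0 : perm rot_inj (Ordinal n0) = x.
    by apply: ord_inj; rewrite permE rotE /= add0n ltn_ord.
  exists 0, 1; split.
    move=> i i0; have -> : i = Ordinal n0 by apply: val_inj => /=; lia.
    by rewrite inE rot0.
  by rewrite (bigD1 (Ordinal n0)) //= rot0 (leq_trans vx) ?leq_addr.
(* A window avoiding [x] does not wrap around the cut, so it is an interval of length [t] starting
   at the offset of [s] from [x]. *)
pose lo := (s + n - x) %% n.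
have rangeE (i : 'I_n) : (lo <= i < lo + t) = (perm rot_inj i \in window n t s).
  move: xw; rewrite !in_window // permE rotE /lo offsetE //.
  have := ltn_ord i; have := ltn_ord x; have := ltn_ord s.
  by do 4 case: ifP; lia.
exists lo, (lo + t); split=> [i|].
  by rewrite rangeE => iw; rewrite inE.
rewrite (leq_trans (hv s)) // (reindex_inj (@perm_inj _ (perm rot_inj))) /=.
by apply/eq_leq/eq_bigl => i; rewrite rangeE.
Qed.

(** Induction on [v]. A residue class inside the support of [a] meets every window once, so deleting
    it lowers every window weight by one; otherwise a window whose weight sits on a single vertex
    [x] forces [v <= a x], and the cycle is cut at [x]. *)
Lemma packs_windows_exceptional n t (a : 'I_n -> nat) v :
  (t, n) \in [:: (3, 6); (3, 9); (4, 8)] ->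
  (forall s : 'I_n, v <= \sum_(i in window n t s) a i) ->
  packs (windows n t) a v.
Proof.
move=> tn; have [dvd_tn lt_tn] : t %| n /\ t < n.
  by move: tn; rewrite !inE => /or3P[] /eqP[-> ->].
elim: v a => [|v IHv] a hv.
  by exists (fun=> setT) => [[]|i] //; rewrite big_ord0.
have [[r lt_rt hr]|[s [x hx]]] := window_center (fun i => 0 < a i) tn.
  have card1 (s : 'I_n) := card_window_class dvd_tn lt_rt (ltn_ord s).
  apply: (packsS (T := residue_class n t r)) => //.
    apply/hittingP => _ /imsetP[s _ ->].
    have [i /andP[ic iw]|h] :=
      pickP (fun i => (i \in residue_class n t r) && (i \in window n t s)).
      by exists i.
    have := card1 s; rewrite big1 // => i iw.
    by have := h i; rewrite iw andbT => ->.
  apply: IHv => s; rewrite -ltnS (leq_trans (hv s)) // -addn1 -(card1 s).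
  rewrite -big_split /=; apply: leq_sum => i _.
  by case: (boolP (i \in _)) => [/hr|_]; lia.
apply: (packs_window_center (x := x)) => //; apply: (leq_trans (hv s)).
rewrite (bigID (pred1 x)) /= [X in _ + X]big1 ?addn0; last first.
  move=> i /andP[iw /eqP ix]; apply/eqP; rewrite -leqn0 leqNgt.
  by apply/negP => /(hx i iw).
rewrite big_mkcondl (bigD1 x) //= big1 ?addn0; last by move=> i /andP[/eqP -> /eqP].
by case: ifP.
Qed.

(** * Relabelling and connected sets *)

Lemma eq_up_to_columns_families n m p (A : 'M[nat]_(n, m)) (B : 'M[nat]_(n, p))
    (f : 'I_m -> {set 'I_n}) (g : 'I_p -> {set 'I_n}) :
  injective f -> injective g -> [set f j | j : 'I_m] = [set g k | k : 'I_p] ->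
  (forall i j, A i j = (i \in f j)) -> (forall i k, B i k = (i \in g k)) ->
  eq_up_to_columns A B.
Proof.
move=> f_inj g_inj fg AE BE.
have /fin_all_exists[s sE] j : exists k, g k = f j.
  have : f j \in [set g k | k : 'I_p] by rewrite -fg imset_f.
  by case/imsetP=> k _ ->; exists k.
have s_inj : injective s by move=> j j' /(congr1 g); rewrite !sE => /f_inj.
exists s; last by move=> i j; rewrite AE BE sE.
apply: inj_card_bij => //.
by rewrite -(card_imset predT f_inj) -(card_imset predT g_inj) fg.
Qed.

Lemma eq_up_to_columns_incidence n p (E : {set {set 'I_n}}) (B : 'M[nat]_(n, p))
    (g : 'I_p -> {set 'I_n}) :
  injective g -> E = [set g k | k : 'I_p] ->
  (forall i k, B i k = (i \in g k)) -> eq_up_to_columns (incidence_mx E) B.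
Proof.
move=> g_inj Eg BE.
apply: (eq_up_to_columns_families (f := enum_val) (g := g)) => //.
- exact: enum_val_inj.
- rewrite -Eg; apply/setP => S; apply/imsetP/idP => [[j _ ->]|SE].
    exact: enum_valP.
  by exists (enum_rank_in SE S); rewrite ?enum_rankK_in.
by move=> i j; rewrite mxE.
Qed.

Lemma eq_up_to_relabelling_incidence n (E E' : {set {set 'I_n}}) (r : 'S_n) :
  E' = relabel r E ->
  eq_up_to_relabelling (incidence_mx E) (incidence_mx E').
Proof.
move=> EE'; exists r.
have r_inj : injective (fun S : {set 'I_n} => r @^-1: S).
  move=> S S' /setP h; apply/setP => i; have := h (r^-1%g i).
  by rewrite !inE permKV.
apply: (@eq_up_to_columns_families _ _ _ _ _
  (fun j => r @^-1: (enum_val j : {set 'I_n})) enum_val).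
- by move=> j j' /r_inj /enum_val_inj.
- exact: enum_val_inj.
- rewrite EE'; apply/setP => S; apply/imsetP/imsetP => -[j _ ->].
    have jE' : r @^-1: enum_val j \in relabel r E.
      by apply: imset_f; apply: enum_valP.
    by exists (enum_rank_in jE' (r @^-1: enum_val j)); rewrite ?enum_rankK_in.
  have /imsetP[S' S'E ->] := enum_valP j.
  by exists (enum_rank_in S'E S'); rewrite ?enum_rankK_in.
- by move=> i j; rewrite !mxE inE.
by move=> i j; rewrite mxE.
Qed.

Lemma incidence_relabelling n (E E' : {set {set 'I_n}}) :
  eq_up_to_relabelling (incidence_mx E) (incidence_mx E') ->
  exists r : 'S_n, E' = relabel r E.
Proof.
case=> r [s s_bij sE]; exists r.
have sE' j : enum_val (s j) = r @^-1: enum_val j.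
  apply/setP => i; rewrite inE; have := sE i j; rewrite !mxE.
  by do 2 case: (_ \in _).
apply/setP => S; apply/idP/imsetP => [SE'|[S0 S0E ->]].
  case: s_bij => s' _ sK; pose j := s' (enum_rank_in SE' S).
  by exists (enum_val j); rewrite ?enum_valP // -sE' /j sK enum_rankK_in.
by rewrite -(enum_rankK_in S0E S0E) -sE' enum_valP.
Qed.

Lemma connect_homo n (e e' : rel 'I_n) (h : 'I_n -> 'I_n) :
  (forall x y, e x y -> e' (h x) (h y)) ->
  forall x y, connect e x y -> connect e' (h x) (h y).
Proof.
move=> eh x _ /connectP[p ep ->]; elim: p x ep => //= y p IHp x /andP[exy /IHp].
by apply: connect_trans; rewrite connect1 ?eh.
Qed.

Lemma connected_preimset n (e e' : rel 'I_n) (r : 'S_n) :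
  (forall i j, e (r i) (r j) = e' i j) ->
  forall S : {set 'I_n}, induced_connected e' (r @^-1: S) = induced_connected e S.
Proof.
move=> ee' S; apply/forall_inP/forall_inP => h x xS; apply/forall_inP => y yS.
  have := h (r^-1%g x); rewrite inE permKV => /(_ xS)/forall_inP/(_ (r^-1%g y)).
  rewrite inE permKV => /(_ yS)/(connect_homo (h := r)) - /(_ (induced_rel e S)).
  rewrite !permKV; apply=> u v; rewrite /induced_rel /= !inE -ee'; exact: id.
rewrite inE in xS; rewrite inE in yS.
have /forall_inP/(_ _ yS) := h _ xS.
move/(connect_homo (h := r^-1%g)) => /(_ (induced_rel e' (r @^-1: S))).
by rewrite !permK; apply=> u v; rewrite /induced_rel /= !inE !permKV -ee' !permKV.
Qed.

Lemma connected_tsets_relabel n (e e' : rel 'I_n) (r : 'S_n) t :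
  (forall i j, e (r i) (r j) = e' i j) ->
  connected_tsets e' t = relabel r (connected_tsets e t).
Proof.
move=> ee'; have card_pre (S : {set 'I_n}) : #|r @^-1: S| = #|S|.
  by apply: on_card_preimset; exists r^-1%g => i _; rewrite ?permK ?permKV.
apply/setP => S; apply/idP/imsetP => [SE|[S' S'E ->]].
  have rS : r @^-1: (r^-1%g @^-1: S) = S by apply/setP => i; rewrite !inE permK.
  exists (r^-1%g @^-1: S); rewrite ?rS //.
  by move: SE; rewrite !inE -(connected_preimset ee') -(card_pre (_ @^-1: _)) rS.
by move: S'E; rewrite !inE (connected_preimset ee') card_pre.
Qed.

(** * Connected sets as intervals of a vertex coordinate *)

Section Intervals.
Variables (n : nat) (e : rel 'I_n) (f : 'I_n -> nat).
Hypothesis e_sym : symmetric e.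

(** Discrete intermediate value: along a walk inside [S] the coordinate rises by at most one at each
    step, so it cannot jump over [c]. *)
Lemma connected_crossing (S : {set 'I_n}) c x y :
  (forall u v, u \in S -> v \in S -> e u v -> f v <= (f u).+1) ->
  induced_connected e S -> x \in S -> y \in S -> f x <= c <= f y ->
  exists2 z, z \in S & f z = c.
Proof.
move=> fe /forall_inP/(_ x) conn xS yS /andP[xc cy].
have /forall_inP/(_ y yS)/connectP[p ep yE] := conn xS.
move: cy; rewrite yE => {y yS yE}.
elim: p x ep xS xc {conn} => [|y p IHp] x /= ep xS xc cy.
  by exists x => //; lia.
case/andP: ep => /and3P[_ yS exy] ep; have [yc|cy'] := leqP (f y) c.
  exact: IHp ep yS yc cy.
by exists x => //; have := fe _ _ xS yS exy; lia.
Qed.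

(** Take [x] with the least coordinate. A member [#|S|] or more above it would, by crossing, force
    [#|S| + 1] values on [S]; thus [S] lies in the stated range, which has at most [#|S|]
    elements. *)
Lemma connected_range (S : {set 'I_n}) :
  injective f ->
  (forall u v, u \in S -> v \in S -> e u v -> f v <= (f u).+1) ->
  induced_connected e S -> S != set0 ->
  exists2 x, x \in S & S = [set i | f x <= f i < f x + #|S|].
Proof.
move=> f_inj fe conn /set0Pn[x0 x0S].
have [x xS xmin] : exists2 x, x \in S & forall y, y \in S -> f x <= f y.
  by case: (arg_minnP f x0S) => x xS h; exists x.
exists x => //; apply/eqP; rewrite eqEcard; apply/andP; split.
  apply/subsetP => y yS; rewrite inE xmin //= ltnNge; apply/negP => hy.
  have /fin_all_exists2[g gS gE] (k : 'I_#|S|.+1) :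
      exists2 z, z \in S & f z = f x + k.
    apply: (connected_crossing fe conn xS yS).
    by rewrite leq_addr (leq_trans _ hy) // leq_add2l -ltnS ltn_ord.
  have g_inj : injective g.
    by move=> k k' /(congr1 f); rewrite !gE => /eqP; rewrite eqn_add2l => /eqP/val_inj.
  suff : #|S| < #|S| by rewrite ltnn.
  rewrite -[X in X <= _]card_ord -(card_imset predT g_inj).
  by apply/subset_leq_card/subsetP => _ /imsetP[k _ ->].
rewrite -[X in _ <= X](size_iota (f x)) [X in X <= _]cardE -(size_map f).
apply: uniq_leq_size; first by rewrite map_inj_uniq ?enum_uniq.
by move=> c /mapP[i iI ->]; move: iI; rewrite mem_enum inE mem_iota.
Qed.

Lemma range_connected lo hi :
  injective f -> (forall u v, f v = (f u).+1 -> e u v) ->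
  (forall c, lo <= c < hi -> exists i, f i = c) ->
  induced_connected e [set i | lo <= f i < hi].
Proof.
move=> f_inj ef surj; set S := finset _.
have up d u v : f v = f u + d -> u \in S -> v \in S ->
    connect (induced_rel e S) u v.
  elim: d v => [|d IHd] v; first by rewrite addn0 => /f_inj ->.
  rewrite addnS => fv uS vS; have [w fw] : exists w, f w = f u + d.
    by apply: surj; move: uS vS; rewrite !inE; lia.
  have wS : w \in S by move: uS vS; rewrite !inE; lia.
  apply: connect_trans (IHd _ fw uS wS) _; apply: connect1.
  by rewrite /induced_rel /= wS vS ef //; lia.
have symS : connect_sym (induced_rel e S).
  by apply: sym_connect_sym => u v; rewrite /induced_rel /= e_sym andbCA.
apply/forall_inP => u uS; apply/forall_inP => v vS.
have [le_uv|/ltnW le_vu] := leqP (f u) (f v).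
  by apply: (up (f v - f u)) => //; lia.
by rewrite symS; apply: (up (f u - f v)) => //; lia.
Qed.

End Intervals.

Lemma card_range n (f : 'I_n -> nat) lo hi :
  injective f -> (forall c, lo <= c < hi -> exists i, f i = c) ->
  #|[set i | lo <= f i < hi]| = hi - lo.
Proof.
move=> f_inj surj; rewrite -[RHS](size_iota lo) cardE -(size_map f).
apply/perm_size/uniq_perm; rewrite ?iota_uniq ?map_inj_uniq ?enum_uniq //.
move=> c; rewrite mem_iota; apply/mapP/idP => [[i + ->]|hc].
  by rewrite mem_enum inE; lia.
have [|i fi] := surj c; first lia.
by exists i; rewrite // mem_enum inE fi; lia.
Qed.

Lemma path_graph_sym n : symmetric (@path_graph n).
Proof. by move=> i j; rewrite /path_graph /= orbC. Qed.

Lemma cycle_graph_sym n : symmetric (@cycle_graph n).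
Proof.
move=> i j; rewrite /cycle_graph /=; congr (_ || _); last exact: orbC.
exact: path_graph_sym.
Qed.

Definition segment n t j : {set 'I_n} := [set i : 'I_n | j <= i < j + t].

Lemma ord_exists n lo hi : hi <= n ->
  forall c, lo <= c < hi -> exists i : 'I_n, i = c :> nat.
Proof.
move=> le_hn c hc; have lt_cn : c < n by lia.
by exists (Ordinal lt_cn).
Qed.

Lemma connected_tsets_path n t : 0 < t <= n ->
  connected_tsets (@path_graph n) t =
  [set segment n t j | j : 'I_(n - t).+1].
Proof.
move=> htn; apply/setP => S; rewrite inE.
apply/andP/imsetP => [[/eqP St conn]|[j _ ->]].
  have S0 : S != set0 by rewrite -card_gt0 St; lia.
  have [|x xS] := connected_range (@ord_inj n) _ conn S0.
    by move=> u v _ _; rewrite /path_graph /=; lia.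
  rewrite St => SE.
  (* The range might overshoot [n]; counting its vertices below [n] shows that it does not. *)
  have SE' : S = [set i : 'I_n | x <= i < minn (x + t) n].
    by rewrite SE; apply/setP => i; rewrite !inE; have := ltn_ord i; lia.
  have : minn (x + t) n - x = t.
    rewrite -(card_range (@ord_inj n)) -?SE' //.
    by apply: ord_exists; lia.
  move=> hx; have lt_x : x < (n - t).+1 by have := ltn_ord x; lia.
  by exists (Ordinal lt_x).
have surj := @ord_exists n j (j + t).
split.
  rewrite (card_range (@ord_inj n)) ?addKn //.
  by apply: surj; have := ltn_ord j; lia.
apply: (range_connected (@path_graph_sym n) (@ord_inj n)).
  by move=> u v; rewrite /path_graph /=; lia.
by apply: surj; have := ltn_ord j; lia.
Qed.

(** The coordinate along the cycle cut open just before [s]. *)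
Definition offset n s (i : 'I_n) := (i + n - s) %% n.

Lemma offset_inj n s : s < n -> injective (@offset n s).
Proof.
move=> lt_sn i j; rewrite /offset !offsetE // => h; apply/ord_inj.
by have := ltn_ord i; have := ltn_ord j; move: h; do 2 case: ifP; lia.
Qed.

Lemma offset_surj n s hi : s < n -> hi <= n ->
  forall c, 0 <= c < hi -> exists i : 'I_n, offset s i = c.
Proof.
move=> lt_sn le_hn c hc; have lt_cn : c < n by lia.
have [i _ iE] := offset_window lt_sn (leqnn n) lt_cn.
exists i; rewrite /offset offsetE // iE.
by do 2 case: ifP; lia.
Qed.

Lemma windowE n t s : window n t s = [set i : 'I_n | 0 <= offset s i < t].
Proof. by []. Qed.

Lemma card_window n t s : s < n -> t <= n -> #|window n t s| = t.
Proof.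
move=> lt_sn le_tn; rewrite windowE card_range ?subn0 //.
  exact: offset_inj.
exact: offset_surj.
Qed.

Lemma window_connected n t s : s < n -> t <= n ->
  induced_connected (@cycle_graph n) (window n t s).
Proof.
move=> lt_sn le_tn; rewrite windowE.
apply: (range_connected (@cycle_graph_sym n) (offset_inj lt_sn)).
  move=> u v; rewrite /offset !offsetE // /cycle_graph /path_graph /=.
  by have := ltn_ord u; have := ltn_ord v; do 2 case: ifP; lia.
exact: offset_surj.
Qed.

(** If each member of [S] had its cyclic predecessor in [S], walking backwards from one member would
    reach every vertex. *)
Lemma cycle_boundary n (S : {set 'I_n}) : S != set0 -> S != setT ->
  exists2 s : 'I_n, s \in S &
    forall i : 'I_n, i.+1 = s \/ s = 0 :> nat /\ i.+1 = n -> i \notin S.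
Proof.
move=> /set0Pn[x xS] ST.
pose B s := [forall i : 'I_n,
  (i.+1 == s :> nat) || (s == 0 :> nat) && (i.+1 == n) ==> (i \notin S)].
have [/existsP[s /andP[sS /forallP hs]]|/existsPn hS] :=
  boolP [exists s : 'I_n, (s \in S) && B s].
  exists s => // i hi; have /implyP := hs i; apply.
  by case: hi => [->|[-> ->]]; rewrite !eqxx ?orbT.
case/eqP: ST; apply/setP => y; rewrite inE.
have [d lt_dn xd] : exists2 d, d < n &
    x = (if y + d < n then y + d else y + d - n) :> nat.
  exists (if y <= x then x - y else x + n - y);
    by have := ltn_ord x; have := ltn_ord y; do ?case: ifP; lia.
elim: d lt_dn y xd => [|d IHd] lt_dn y.
  by rewrite addn0 ltn_ord => /ord_inj <-.
rewrite addnS => xd.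
have lt_y' : (if y.+1 < n then y.+1 else 0) < n by case: ifP; lia.
pose y' := Ordinal lt_y'.
have y'S : y' \in S.
  apply: IHd; first lia.
  by rewrite xd /=; have := ltn_ord y; do ?case: ifP; lia.
have := hS y'; rewrite y'S /= => /forallPn[i].
rewrite negb_imply negbK /= => /andP[hi].
have -> // : i = y.
apply: ord_inj; have := ltn_ord y; have := ltn_ord i; move: hi.
by case: ifP; lia.
Qed.

(** Cut the cycle before a vertex [s] of [S] whose predecessor is outside [S]: no edge inside [S]
    crosses the cut, so [connected_range] applies to the offsets from [s]. The full vertex set is
    treated apart. *)
Lemma connected_tsets_cycle n t : 0 < t <= n ->
  connected_tsets (@cycle_graph n) t = windows n t.
Proof.
move=> htn; apply/setP => S; rewrite inE.
apply/andP/imsetP => [[/eqP St conn]|[s _ ->]]; last first.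
  by rewrite card_window ?window_connected //; lia.
have S0 : S != set0 by rewrite -card_gt0 St; lia.
have [ST|/cycle_boundary ex_s] := eqVneq S setT.
  have [x _] := set0Pn _ S0; exists x => //; apply/eqP.
  rewrite eq_sym eqEcard ST cardsT card_ord card_window //; last by lia.
  by rewrite subsetT -[n in X in X <= _]card_ord -cardsT -ST St /=.
have [s sS hs] := ex_s S0.
have [|x xS] := connected_range (offset_inj (ltn_ord s)) _ conn S0.
  move=> u v uS vS; rewrite /cycle_graph /path_graph /offset !offsetE //= => uv.
  have hu : ~ (u.+1 = s \/ s = 0 :> nat /\ u.+1 = n) by move/hs; rewrite uS.
  have hv : ~ (v.+1 = s \/ s = 0 :> nat /\ v.+1 = n) by move/hs; rewrite vS.
  have := ltn_ord u; have := ltn_ord v; have := ltn_ord s.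
  by do 2 case: ifP; lia.
rewrite St => SE; exists s => //; rewrite SE windowE.
have s0 : offset s s = 0 by rewrite /offset addKn modnn.
have := sS; rewrite SE inE s0 leqn0 => /andP[/eqP -> _].
by rewrite add0n.
Qed.

(** For [t < n] the start is the only vertex of a window whose cyclic predecessor lies outside
    it. *)
Lemma window_inj n t s s' : 0 < t < n -> s < n -> s' < n ->
  window n t s = window n t s' -> s = s'.
Proof.
move=> htn lt_sn lt_s'n /setP ww; apply/eqP; rewrite -[_ == _]negbK; apply/negP => ss'.
have := ww (Ordinal lt_sn).
have lt_pn : (if s == 0 then n.-1 else s.-1) < n by case: eqP; lia.
have := ww (Ordinal lt_pn); rewrite !in_window //=.
by case: eqP; do ?case: ifP; lia.
Qed.

Lemma path_columns n t : 0 < t <= n ->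
  eq_up_to_columns (tconn_mx (@path_graph n) t) (path_mx t n).
Proof.
move=> htn; apply: (@eq_up_to_columns_incidence _ _
  (connected_tsets (@path_graph n) t) _ (fun j => segment n t j)).
- move=> j j' /setP jj'.
  have lt_jn : j < n by have := ltn_ord j; lia.
  have lt_jn' : j' < n by have := ltn_ord j'; lia.
  have := jj' (Ordinal lt_jn); have := jj' (Ordinal lt_jn').
  by rewrite !inE /= => h h'; apply: ord_inj; lia.
- exact: connected_tsets_path.
by move=> i j; rewrite mxE inE.
Qed.

Lemma cycle_columns n t : 0 < t <= n ->
  eq_up_to_columns (tconn_mx (@cycle_graph n) t) (cycle_mx t n).
Proof.
move=> htn; pose p := if t < n then n else 1.
have lt_pn (j : 'I_p) : j < n.
  by apply: leq_trans (ltn_ord j) _; rewrite /p; case: ifP; lia.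
apply: (@eq_up_to_columns_incidence _ _
  (connected_tsets (@cycle_graph n) t) _ (fun j => window n t j)).
- move=> j j' jj'; apply: ord_inj.
  have [lt_tn|le_nt] : t < n \/ n <= t by lia.
    by apply: window_inj jj' => //; lia.
  have p1 : p = 1 by rewrite /p ltnNge le_nt.
  have lt_j1 (k : 'I_p) : k < 1 by apply: leq_trans (ltn_ord k) _; rewrite p1.
  by have := lt_j1 j; have := lt_j1 j'; rewrite !ltnS !leqn0 => /eqP -> /eqP ->.
- rewrite connected_tsets_cycle //; apply/setP => S.
  apply/imsetP/imsetP => -[j _ ->]; last by exists (Ordinal (lt_pn j)).
  have [lt_tn|le_nt] : t < n \/ n <= t by lia.
    have lt_jp : j < if t < n then n else 1 by rewrite lt_tn.
    by exists (Ordinal lt_jp).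
  have lt_0p : 0 < if t < n then n else 1 by case: ifP; lia.
  exists (Ordinal lt_0p) => //; apply/setP => i; rewrite !inE.
  have n0 : 0 < n by lia.
  by rewrite !(leq_trans (ltn_pmod _ n0) le_nt).
by move=> i j; rewrite mxE inE.
Qed.

(** * The degree bound *)

Section Connected.
Variables (n : nat) (e : rel 'I_n).
Hypotheses (e_sym : symmetric e) (e_irr : irreflexive e).
Hypothesis e_conn : connected_graph e.

Lemma induced_sym (S : {set 'I_n}) : connect_sym (induced_rel e S).
Proof. by apply: sym_connect_sym => u v; rewrite /induced_rel /= e_sym andbCA. Qed.

Lemma connected_from (S : {set 'I_n}) c :
  (forall x, x \in S -> connect (induced_rel e S) c x) -> induced_connected e S.
Proof.
move=> h; apply/forall_inP => u uS; apply/forall_inP => v vS.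
by apply: connect_trans (h v vS); rewrite induced_sym; apply: h.
Qed.

Lemma connected_star (S : {set 'I_n}) c :
  c \in S -> (forall x, x \in S -> x != c -> e c x) -> induced_connected e S.
Proof.
move=> cS h; apply: (connected_from (c := c)) => x xS.
have [->|xc] := eqVneq x c; first exact: connect0.
by apply: connect1; rewrite /induced_rel /= cS xS h.
Qed.

Lemma connected_setU1 (S : {set 'I_n}) x w :
  induced_connected e S -> x \in S -> e x w -> induced_connected e (w |: S).
Proof.
move=> /forall_inP conn xS exw; apply: (connected_from (c := x)) => y.
case/setU1P=> [->|yS].
  by apply: connect1; rewrite /induced_rel /= !inE eqxx xS orbT.
have /forall_inP/(_ y yS) := conn x xS; apply: connect_sub => u v.
by case/and3P=> uS vS euv; apply: connect1; rewrite /induced_rel /= !inE uS vS !orbT.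
Qed.

Lemma exists_boundary_edge (S : {set 'I_n}) :
  S != set0 -> S != setT -> exists x w, [/\ x \in S, w \notin S & e x w].
Proof.
move=> /set0Pn[x0 x0S]; rewrite -subTset => /subsetPn[y _ yS].
have [/existsP[x /existsP[w /and3P[]]]|no_edge] :=
  boolP [exists x, exists w, [&& x \in S, w \notin S & e x w]].
  by exists x, w.
have /forall_inP/(_ y (in_setT y)) := forall_inP e_conn _ (in_setT x0).
have clS : closed (induced_rel e setT) (mem S).
  apply: (intro_closed (induced_sym _)) => u v /and3P[_ _ euv] uS.
  apply: contraNT no_edge => vS; apply/existsP; exists u; apply/existsP; exists v.
  by rewrite uS euv vS.
move/(closed_connect clS) => xy; suff : y \in S by rewrite (negbTE yS).
exact: (etrans (esym xy) x0S).
Qed.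

Definition noncut (S : {set 'I_n}) : {set 'I_n} :=
  [set x in S | induced_connected e (S :\ x)].

(* Attaching w to x may turn x into a cut vertex, but w itself is not one. *)
Lemma card_noncut_setU1 (S : {set 'I_n}) x w :
  induced_connected e S -> x \in S -> w \notin S -> e x w ->
  #|noncut S| <= #|noncut (w |: S)|.
Proof.
move=> conn xS wS exw.
have wN : w \notin noncut S :\ x by rewrite !inE (negbTE wS) andbF.
have : w |: (noncut S :\ x) \subset noncut (w |: S).
  apply/subsetP => y; rewrite !inE => /orP[/eqP ->|/and3P[yx yS ySconn]].
    by rewrite eqxx /= setU1K.
  rewrite yS orbT /=.
  have -> : (w |: S) :\ y = w |: (S :\ y).
    have yw : y != w by apply: contraNneq wS => <-.
    by apply/setP => z; rewrite !inE; case: (eqVneq z w) => [->|]; rewrite //= eq_sym yw.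
  by apply: connected_setU1 exw; rewrite // !inE eq_sym yx.
move/subset_leq_card; apply: leq_trans.
by rewrite cardsU1 wN; have := cardsD1 x (noncut S); case: (x \in _) => /=; lia.
Qed.

Lemma grow_connected (S : {set 'I_n}) m :
  S != set0 -> induced_connected e S -> #|S| <= m <= n ->
  exists S', [/\ induced_connected e S', #|S'| = m & #|noncut S| <= #|noncut S'|].
Proof.
move=> S0 conn /andP[/subnKC <-]; elim: (m - #|S|) => [|d IHd] hn.
  by exists S; rewrite addn0.
have [|S' [conn' cardS' le]] := IHd; first by move: hn; rewrite addnS; apply: ltnW.
have S'0 : S' != set0.
  by rewrite -card_gt0 cardS' (leq_trans _ (leq_addr _ _)) // card_gt0.
have S'T : S' != setT.
  apply/eqP => S'T; move: hn; rewrite addnS -cardS' S'T cardsT card_ord.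
  by rewrite ltnn.
have [x [w [xS' wS' exw]]] := exists_boundary_edge S'0 S'T.
exists (w |: S'); split; first exact: connected_setU1 exw.
  by rewrite cardsU1 wS' cardS' addnS add1n.
exact: leq_trans le (card_noncut_setU1 conn' xS' wS' exw).
Qed.

(** For [alpha = 1], give weight 1 to the non-cut vertices of [Y] and 2 to its cut vertices. Since
    [Y] minus a non-cut vertex is a connected [t]-set, a transversal contains a cut vertex or two
    non-cut ones, so it weighs at least 2. Duality gives [2 t <= 2 (t + 1) - #|noncut Y|]. *)
Lemma card_noncut_le2 (Y : {set 'I_n}) t :
  (forall alpha, tau_eq_nu (min_solutions_mx (tconn_mx e t)) alpha) ->
  induced_connected e Y -> #|Y| = t.+1 -> #|noncut Y| <= 2.
Proof.
move=> hB conn cardY; rewrite leqNgt; apply/negP => N3.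
pose u i := if i \in Y then (i \notin noncut Y).+1 else 0.
have : t * 2 <= \sum_i 1 * u i.
  apply: (dual_bound (hB _)).
    by move=> S; rewrite inE sum1_card => /andP[/eqP ->].
  move=> T /hittingP hT _.
  have hit v : v \in noncut Y -> exists2 x, x \in T & x \in Y :\ v.
    move=> vN; apply: hT; move: (vN); rewrite !inE => /andP[vY ->].
    by have := cardsD1 v Y; rewrite vY cardY add1n => -[<-]; rewrite eqxx.
  have [v vN] : exists v, v \in noncut Y by apply/set0Pn; rewrite -card_gt0; lia.
  have [x xT xYv] := hit v vN; have xY : x \in Y by case/setD1P: xYv.
  rewrite (bigD1 x) //= {1}/u xY.
  have [xN|] := boolP (x \in noncut Y); last by [].
  have [y yT /setD1P[yx yY]] := hit x xN.
  rewrite (bigD1 y) ?yT //= {1}/u yY.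
  by lia.
under eq_bigr => i _ do rewrite mul1n.
have -> : \sum_i u i = \sum_(i in Y) 1 + \sum_(i in Y :\: noncut Y) 1.
  rewrite [X in _ = X + _]big_mkcond [X in _ = _ + X]big_mkcond -big_split /=.
  apply: eq_bigr => i _; rewrite /u in_setD andbC.
  by case: (i \in Y) => //=; case: (i \in noncut Y).
have NY : noncut Y \subset Y by apply/subsetP => i; rewrite inE => /andP[].
have := subset_leq_card NY.
by rewrite !sum1_card cardsD (setIidPr NY) cardY; lia.
Qed.

(** Removing a leaf from the star formed by [c] and three neighbours leaves a star, so the leaves
    are non-cut. The star has at most [t + 1] vertices and grows to exactly [t + 1], keeping at
    least three non-cut vertices. *)
Lemma degree_le2 t c a b d :
  3 <= t < n ->
  (forall alpha, tau_eq_nu (min_solutions_mx (tconn_mx e t)) alpha) ->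
  uniq [:: a; b; d] -> e c a -> e c b -> e c d -> False.
Proof.
move=> htn hB abd eca ecb ecd.
pose S := [set x in [:: c; a; b; d]].
have ne x : e c x -> c != x by move=> ecx; apply: contraTneq ecx => <-; rewrite e_irr.
have star (X : {set 'I_n}) : c \in X -> X \subset S -> induced_connected e X.
  move=> cX /subsetP XS; apply: (connected_star cX) => x /XS.
  by rewrite !inE => /or4P[] /eqP -> //; rewrite eqxx.
have cS : c \in S by rewrite !inE eqxx.
have noncutS x : x \in S -> c != x -> x \in noncut S.
  by move=> xS cx; rewrite inE xS star // ?subD1set // !inE cx eqxx.
have N3 : 2 < #|noncut S|.
  rewrite -[3]/(size [:: a; b; d]) -(card_uniqP abd); apply/subset_leq_card/subsetP => x.
  move=> xs; apply: noncutS; move: xs; rewrite !inE => /or3P[] /eqP ->;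
    by rewrite ?ne ?eqxx ?orbT.
have S0 : S != set0 by apply/set0Pn; exists c.
have le4 : #|S| <= 4.
  by rewrite cardsE card_size.
have [|Y [conn cardY le]] := @grow_connected S t.+1 S0 (star S cS (subxx _)).
  by rewrite (leq_trans le4) /=; lia.
have := card_noncut_le2 hB conn cardY; lia.
Qed.

End Connected.

(* A longest path has all neighbours of its vertices on it, hence it is
   Hamiltonian; the only chord left by the degree bound joins its ends. *)
Lemma degree_le2_path_or_cycle n (e : rel 'I_n) :
  symmetric e -> irreflexive e -> connected_graph e -> 0 < n ->
  (forall c a b d, uniq [:: a; b; d] -> e c a -> e c b -> e c d -> False) ->
  exists r : 'S_n, (forall i j, e (r i) (r j) = path_graph i j) \/
                   (forall i j, e (r i) (r j) = cycle_graph i j).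
Proof.
move=> e_sym e_irr e_conn n0 deg2; pose x0 := Ordinal n0.
pose P k := [exists p : k.-tuple 'I_n, uniq p && sorted e p].
have exP : exists k, P k by exists 1; apply/existsP; exists [tuple x0].
have boundP k : P k -> k <= n.
  case/existsP=> p /andP[/card_uniqP up _].
  by rewrite -[k](size_tuple p) -up -[X in _ <= X]card_ord max_card.
case: (ex_maxnP exP boundP) => k /existsP[[p /= /eqP sz] /andP[/= up sp]] kmax.
pose g := nth x0 p.
have k0 : 0 < k by apply: kmax; apply/existsP; exists [tuple x0].
have g_adj i : i.+1 < k -> e (g i) (g i.+1).
  by move: sp => /(sortedP x0); rewrite sz; apply.
have g_in i : i < k -> g i \in p by move=> ik; rewrite mem_nth ?sz.
have g_eq i j : i < k -> j < k -> (g i == g j) = (i == j).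
  by move=> ik jk; rewrite nth_uniq ?sz.
have longer (q : seq 'I_n) : size q = k.+1 -> uniq q -> sorted e q -> False.
  move=> /eqP sq uq eq_; have : k.+1 <= k.
    by apply: kmax; apply/existsP; exists (Tuple sq); rewrite /= uq.
  by rewrite ltnn.
(* A neighbour off the path would extend it at an end, or be a third neighbour of an inner
   vertex. *)
have nb i w : i < k -> e (g i) w -> w \in p.
  move=> ik ew; apply/negPn/negP => wp.
  have [i0|i_n0] := posnP i.
    apply: (longer (w :: p)); rewrite /= ?sz ?wp //.
    move: sp ew; rewrite i0 /g; case: (p) sz => [|y q] /=; first lia.
    by move=> _ -> ; rewrite e_sym => ->.
  have [ik1|ik1] := ltnP i.+1 k.
    apply: (deg2 (g i) (g i.-1) (g i.+1) w) => //; last exact: g_adj.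
      have wne j : j < k -> g j != w.
        by move=> jk; apply: contraNneq wp => <-; apply: g_in.
      rewrite /= !inE negb_or !wne ?g_eq; try lia.
    by rewrite e_sym -{2}(prednK i_n0); apply: g_adj; lia.
  apply: (longer (rcons p w)); rewrite ?size_rcons ?sz ?rcons_uniq ?wp //.
  have gl : g i = g k.-1 by congr g; lia.
  move: sp ew; rewrite gl /g -sz nth_last; case: (p) (sz) => [|y q] /=; first lia.
  by move=> _ sq eqw; rewrite rcons_path sq.
have in_p x : x \in p.
  have [pT|pT] := eqVneq [set y in p] setT.
    by move/setP: pT => /(_ x); rewrite !inE.
  have p0 : [set y in p] != set0.
    by apply/set0Pn; exists (g 0); rewrite inE g_in.
  have [y [w []]] := exists_boundary_edge e_sym e_conn p0 pT.
  rewrite !inE => yp wp eyw; case/negP: wp.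
  apply: (nb (index y p)); first by rewrite -sz index_mem.
  by rewrite /g nth_index.
have kn : k = n.
  rewrite -sz -(card_uniqP up) -[RHS]card_ord; apply: eq_card => x.
  by rewrite in_p.
have h_inj : injective (fun i : 'I_n => g i).
  by move=> i j /eqP; rewrite g_eq ?kn // => /eqP /ord_inj.
(* A chord at an inner vertex of the path would give it three neighbours. *)
have chord i j : i < j -> j < n -> e (g i) (g j) ->
    j = i.+1 \/ i = 0 /\ j.+1 = n.
  move=> ij jn eij; have [->|ji] := eqVneq j i.+1; first by left.
  right; have [i0|i_n0] := posnP i; last first.
    case: (deg2 (g i) (g i.-1) (g i.+1) (g j)) => //; last by apply: g_adj; lia.
      by rewrite /= !inE !g_eq; lia.
    by rewrite e_sym -{2}(prednK i_n0); apply: g_adj; lia.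
  split=> //; have [jn1|] := ltnP j.+1 n; last by lia.
  case: (deg2 (g j) (g j.-1) (g j.+1) (g i)).
  - by rewrite /= !inE !g_eq; lia.
  - by rewrite e_sym -{2}(prednK (n := j)); [apply: g_adj; lia|lia].
  - by apply: g_adj; lia.
  by rewrite e_sym.
have reduce (e' : rel 'I_n) : symmetric e' -> irreflexive e' ->
    (forall i j : 'I_n, i < j -> e (g i) (g j) = e' i j) ->
    forall i j, e (perm h_inj i) (perm h_inj j) = e' i j.
  move=> e'_sym e'_irr lt_e i j; rewrite !permE.
  case: (ltngtP i j) => [|ji|/ord_inj ->]; first exact: lt_e.
    by rewrite e_sym e'_sym lt_e.
  by rewrite e_irr e'_irr.
exists (perm h_inj).
(* For [n = 2] the edge between the ends is the path edge itself, hence the test [2 < n]. *)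
have [/andP[n2 e0]|no] := boolP ((2 < n) && e (g 0) (g n.-1)).
  right; apply: reduce => [i j|i|i j ij]; rewrite /cycle_graph /path_graph /=.
  - by lia.
  - by lia.
  apply/idP/idP => [/(chord _ _ ij (ltn_ord j))|]; first lia.
  case/orP=> [ij1|/orP[ij1|]]; last 1 first.
  - by lia.
  - have -> : j = i.+1 :> nat by lia.
    by apply: g_adj; have := ltn_ord j; lia.
  have -> : i = 0 :> nat by lia.
  by have -> : j = n.-1 :> nat by lia.
left; apply: reduce => [i j|i|i j ij]; rewrite /path_graph /=.
- by lia.
- by lia.
apply/idP/idP => [eij|ij1].
  have [|[i0 jn]] := chord _ _ ij (ltn_ord j) eij; first lia.
  have jE : j = n.-1 :> nat by lia.
  by move: no eij; rewrite i0 jE => no eij; move: no; rewrite eij andbT; lia.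
have -> : j = i.+1 :> nat by lia.
by apply: g_adj; have := ltn_ord j; lia.
Qed.

(** * Windows of a cycle *)

(** The consequence of [dual_bound], stated apart from the matrices so that it can be moved along a
    relabelling to the windows. *)
Definition duality_bounds n (E : {set {set 'I_n}}) : Prop :=
  forall (a u : 'I_n -> nat) (l c : nat),
  (forall S, S \in E -> l <= \sum_(i in S) a i) ->
  (forall T, hitting E T -> (forall i, i \in T -> 0 < a i) ->
     c <= \sum_(i in T) u i) ->
  l * c <= \sum_i a i * u i.

Lemma sum_preimset n (r : 'S_n) (S : {set 'I_n}) (a : 'I_n -> nat) :
  \sum_(i in r @^-1: S) a i = \sum_(i in S) a (r^-1%g i).
Proof.
rewrite [RHS](reindex_inj (@perm_inj _ r)) /=.
by apply: eq_big => i; rewrite ?inE // permK.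
Qed.

Lemma duality_bounds_relabel n (r : 'S_n) (E : {set {set 'I_n}}) :
  (forall alpha, tau_eq_nu (min_solutions_mx (incidence_mx E)) alpha) ->
  duality_bounds (relabel r E).
Proof.
move=> hE a u l c hl hc.
rewrite (reindex_inj (@perm_inj _ r^-1%g)) /=.
apply: (dual_bound (hE _)) => [S SE|T /hittingP hT Ta].
  by rewrite -sum_preimset; apply: hl; apply: imset_f.
rewrite -sum_preimset; apply: hc.
  apply/hittingP => _ /imsetP[S SE ->]; have [i iT iS] := hT S SE.
  by exists (r^-1%g i); rewrite inE permKV.
by move=> i; rewrite inE => /Ta; rewrite permK.
Qed.

Section Windows.
Variables (n t : nat).
Hypotheses (t0 : 0 < t) (lt_tn : t < n).

Lemma sum_card_window (T : {set 'I_n}) :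
  \sum_(s < n) \sum_(i in T) (i \in window n t s) = #|T| * t.
Proof.
rewrite exchange_big -sum_nat_const; apply: eq_bigr => i _ /=.
(* For fixed [i], the offset from [s] is a bijective function of [s], so [i] lies in exactly [t]
   windows. *)
rewrite -[RHS]subn0.
rewrite -(card_range (f := fun s : 'I_n => (i + n - s) %% n) (lo := 0)).
- rewrite -sum1_card [RHS]big_mkcond; apply: eq_bigr => s _.
  by rewrite !inE; case: (_ < t).
- move=> s s'; rewrite !offsetE // => h; apply: ord_inj.
  have := ltn_ord s; have := ltn_ord s'; have := ltn_ord i.
  by move: h; do 2 case: ifP; lia.
move=> c hc.
have lt_sn : (if c <= i then i - c else i + n - c) < n.
  by have := ltn_ord i; case: ifP; lia.
exists (Ordinal lt_sn); rewrite offsetE //=.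
by have := ltn_ord i; do ?case: ifP; lia.
Qed.

Lemma hitting_window (T : {set 'I_n}) (s : 'I_n) : hitting (windows n t) T ->
  0 < \sum_(i in T) (i \in window n t s).
Proof.
move=> /hittingP hT; have [|i iT iw] := hT (window n t s); first exact: imset_f.
by rewrite (bigD1 i) //= iw.
Qed.

Lemma card_hitting_windows T : hitting (windows n t) T -> n <= #|T| * t.
Proof.
move=> hT; rewrite -sum_card_window -[X in X <= _]card_ord -sum1_card.
by apply: leq_sum => s _; apply: hitting_window.
Qed.

(** With all weights 1, windows weigh [t] and transversals have at least [c], the ceiling of
    [n / t], elements; duality gives [t * c <= n], which forces equality. *)
Lemma windows_dvdn : duality_bounds (windows n t) -> t %| n.
Proof.
move=> H; pose c := (n.-1 %/ t).+1.
have : t * c <= \sum_(i < n) 1 * 1.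
  apply: (H (fun=> 1) (fun=> 1)) => [_ /imsetP[s _ ->]|T hT _].
    by rewrite sum1_card card_window // ltnW.
  by rewrite sum1_card ltn_divLR //; have := card_hitting_windows hT; lia.
rewrite sum_nat_const card_ord !muln1 => le_n.
have := ltn_ceil n.-1 t0; rewrite -/c => ge_n.
by apply/dvdnP; exists c; lia.
Qed.

(* If T has n / t elements, the double count is tight: every window contains
   one element of T, so T is invariant under the shift by t. *)
Lemma hitting_shift T (x : 'I_n) m : t %| n -> hitting (windows n t) T ->
  #|T| * t <= n -> x \in T ->
  exists2 y : 'I_n, y \in T & y = (x + m * t) %% n :> nat.
Proof.
move=> dvd_tn hT cardT xT.
pose w (s : 'I_n) := \sum_(i in T) (i \in window n t s).
(* Each window counts at least one and the counts sum to at most [n], so none exceeds one. *)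
have w1 s : w s <= 1.
  rewrite leqNgt; apply/negP => w2.
  suff : n < n by rewrite ltnn.
  have le_w : n.-1 <= \sum_(i < n | i != s) w i.
    rewrite -[X in X.-1]card_ord -(cardC1 s) -sum1_card.
    by apply: leq_sum => i _; apply: hitting_window.
  apply: leq_trans cardT; rewrite -sum_card_window (bigD1 s) //=.
  by apply: leq_trans (leq_add w2 le_w); have := ltn_ord s; lia.
elim: m => [|m [y yT yE]].
  by exists x; rewrite // mul0n addn0 modn_small.
suff [z zT zE] : exists2 z : 'I_n, z \in T &
    z = (if y + t < n then y + t else y + t - n) :> nat.
  exists z; rewrite // zE mulSnr addnA -modnDml -yE; case: ltnP => h.
    by rewrite modn_small.
  by rewrite -[in RHS](subnK h) modnDr modn_small //; have := ltn_ord y; lia.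
(* The window starting right after [y] is hit at some [z]; as the window of [y] contains no other
   element of [T], this [z] is the last vertex, [y + t] modulo [n]. *)
have lt_sn : (if y.+1 < n then y.+1 else 0) < n by case: ifP; lia.
pose s := Ordinal lt_sn.
have /hittingP/(_ (window n t s))[|z zT zs] := hT; first exact: imset_f.
have zy : z != y.
  apply: contraTneq zs => ->; rewrite in_window //=.
  by have := ltn_ord y; do ?case: ifP; lia.
have zNy : z \notin window n t y.
  apply/negP => zwy; have := w1 y.
  rewrite /w (bigD1 y) //= (bigD1 z) ?zT //= zwy in_window // leqnn subnn t0.
  by lia.
exists z => //; move: zs zNy zy; rewrite !in_window // -val_eqE /=.
by have := ltn_ord y; have := ltn_ord z; do ?case: ifP; lia.
Qed.

End Windows.

(** * Zero-one arrays violating duality *)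

Lemma sum_divn_modn k t (F : nat -> nat -> nat) : 0 < t ->
  \sum_(0 <= i < k * t) F (i %/ t) (i %% t) =
  \sum_(0 <= q < k) \sum_(0 <= r < t) F q r.
Proof.
move=> t0; elim: k => [|k IHk]; first by rewrite mul0n !big_nil.
rewrite mulSnr (big_cat_nat (n := k * t)) ?leq_addr //= IHk big_nat_recr //=.
congr (_ + _); rewrite -{1}[k * t]add0n big_addn addKn.
apply: eq_big_nat => r /andP[_ lt_rt].
by rewrite addnC divnMDl // divn_small // addn0 modnMDl modn_small.
Qed.

Lemma sum_nth_count (b : bitseq) m :
  \sum_(0 <= r < m) nth false b r <= count id b.
Proof.
elim: b m => [|x b IHb] [|m]; rewrite ?big_nil //.
  by rewrite big1 // => i _; rewrite nth_nil.
by rewrite big_nat_recl //= leq_add2l IHb.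
Qed.

(* The vertices q t + r of the cycle are arranged in a k x t array; the window
   starting at q t + r0 runs through the columns r >= r0 of row q and the
   columns r < r0 of the next row. *)
Definition window_row k q r0 r : nat :=
  if r0 <= r then q else if q.+1 < k then q.+1 else 0.


Lemma count_gt1 (p : pred nat) m : 1 < count p (iota 0 m) ->
  exists x y, [/\ x != y, x < m, y < m, p x & p y].
Proof.
rewrite -size_filter; have := filter_uniq p (iota_uniq 0 m).
have mem x : (x \in [seq x <- iota 0 m | p x]) = p x && (x < m).
  by rewrite mem_filter mem_iota.
case: filter mem => [|x [|y l]] // mem.
rewrite /= inE negb_or => /andP[/andP[xy _] _] _.
have := mem x; have := mem y; rewrite !inE !eqxx orbT.
by move=> /esym/andP[py ym] /esym/andP[px xm]; exists x, y.
Qed.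
(** Put the 0/1 weights [f] on the vertices [q t + r]. Every window weighs at least 2. A transversal
    inside the support has more than [k] elements: with at most [k] it would be closed under shifts
    by [t], and so contain a zero entry of a column that it meets. Duality yields
    [2 (k + 1) <= 2 k + 1]. *)
Lemma weight_array_contra n k t (f : nat -> nat -> bool) :
  1 < k -> 0 < t -> n = k * t -> duality_bounds (windows n t) ->
  (forall r, r < t -> exists2 q, q < k & ~~ f q r) ->
  (forall q r0, q < k ->
     1 < count (fun r => f (window_row k q r0 r) r) (iota 0 t)) ->
  \sum_(0 <= q < k) \sum_(0 <= r < t) f q r <= k.*2.+1 ->
  False.
Proof.
move=> k1 t0 nkt H zero two total.
have lt_tn : t < n by rewrite nkt -[X in X < _]mul1n ltn_mul2r t0.
have dvd_tn : t %| n by rewrite nkt dvdn_mull.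
pose a (i : 'I_n) : nat := f (i %/ t) (i %% t).
have : 2 * k.+1 <= \sum_(i < n) a i * 1.
  apply: (H a (fun=> 1)) => [_ /imsetP[s _ ->]|T hT Ta]; last first.
    rewrite sum1_card ltnNge; apply/negP => le_Tk.
    have le_T : #|T| * t <= n by rewrite [X in _ <= X]nkt leq_mul2r le_Tk orbT.
    have T0 : 0 < #|T|.
      have := card_hitting_windows t0 lt_tn hT.
      by case: #|T| => //; rewrite mul0n; lia.
    have [x xT] : exists x, x \in T by apply/set0Pn; rewrite -card_gt0.
    have [q lt_qk] := zero _ (ltn_pmod x t0); rewrite -[~~ _]/(~~ _) => nf.
    (* This shift leads from row [x %/ t] to row [q] in the same column; the added [k] is a full
       turn that keeps the subtraction exact. *)
    have [y yT] := hitting_shift t0 lt_tn (q + k - x %/ t) dvd_tn hT le_T xT.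
    have lt_xk : x %/ t < k by rewrite ltn_divLR // -nkt.
    have -> : x + (q + k - x %/ t) * t = q * t + x %% t + n.
      rewrite mulnBl mulnDl -nkt {1}(divn_eq x t).
      have : x %/ t * t <= n by rewrite [X in _ <= X]nkt leq_mul2r ltnW ?orbT.
      set A := x %/ t * t; set B := q * t; set C := x %% t => le_A.
      lia.
    have lt_qr : q * t + x %% t < n.
      rewrite [X in _ < X]nkt; apply: (@leq_trans (q.+1 * t)).
        by rewrite mulSnr ltn_add2l ltn_pmod.
      by rewrite leq_mul2r lt_qk orbT.
    rewrite modnDr modn_small // => yE; have := Ta y yT.
    rewrite /a yE divnMDl // divn_small ?ltn_pmod // addn0 modnMDl modn_mod.
    by rewrite (negbTE nf).
  have lt_qk : s %/ t < k by rewrite ltn_divLR // -nkt.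
  have [r [r' [rr' lt_rt lt_r't gr gr']]] := count_gt1 (two _ (s %% t) lt_qk).
  have [r0 r0E] : exists r0, r0 = s %% t by exists (s %% t).
  have [q qE] : exists q, q = s %/ t by exists (s %/ t).
  have lt_r0 : r0 < t by rewrite r0E ltn_pmod.
  have sE : s = q * t + r0 :> nat by rewrite qE r0E -divn_eq.
  pose row := window_row k q r0.
  have elt v : v < t -> f (row v) v -> exists2 i : 'I_n,
      i \in window n t s & a i = 1 /\ i %% t = v.
    move=> lt_vt fv.
    have lt_row : row v < k.
      by rewrite /row /window_row; move: lt_qk; rewrite -qE; do ?case: ifP; lia.
    have lt_in : row v * t + v < n.
      rewrite [X in _ < X]nkt; apply: (@leq_trans ((row v).+1 * t)).
        by rewrite mulSnr ltn_add2l.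
      by rewrite leq_mul2r lt_row orbT.
    exists (Ordinal lt_in).
      rewrite in_window //= sE.
      have := ltn_ord s; rewrite /row /window_row -qE in lt_qk *.
      have [le_r0v|lt_vr0] := leqP r0 v.
        by rewrite leq_add2l le_r0v; lia.
      have [lt_q|le_q] := ltnP q.+1 k.
        by rewrite mulSn; case: ifP; lia.
      have kE : k = q.+1 by lia.
      have nE : n = q * t + t by rewrite nkt kE mulSnr.
      by rewrite mul0n add0n; case: ifP; lia.
    by rewrite /a /= divnMDl // (divn_small lt_vt) addn0 modnMDl (modn_small lt_vt) fv.
  rewrite -r0E -qE -!/(row _) in gr gr'.
  have [i iw [ai ir]] := elt r lt_rt gr.
  have [i' iw' [ai' ir']] := elt r' lt_r't gr'.
  have ii' : i' != i.
    by apply: contra_neq rr' => ii'; rewrite -ir -ir' ii'.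
  by rewrite (bigD1 i) //= (bigD1 i') ?iw' //= ai ai'.
under eq_bigr => i _ do rewrite muln1.
rewrite -(big_mkord xpredT (fun i => f (i %/ t) (i %% t) : nat)).
rewrite nkt (sum_divn_modn k (fun q r => f q r : nat)) //.
by lia.
Qed.

(** Rows past the listed ones equal [d], and columns past the listed entries are zero. *)
Definition array (rows : seq bitseq) (d : bitseq) (q r : nat) : bool :=
  nth false (nth d rows q) r.

(** Only the first [w] columns are tested for two ones per window; further columns can only raise
    the count. *)
Lemma array_contra rows d w n k t :
  1 < k -> 0 < t -> w <= t -> n = k * t -> duality_bounds (windows n t) ->
  (forall r, r < t -> exists2 q, q < k & ~~ array rows d q r) ->
  (forall q r0, q < k ->
     1 < count (fun r => array rows d (window_row k q r0 r) r) (iota 0 w)) ->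
  \sum_(0 <= q < k) count id (nth d rows q) <= k.*2.+1 -> False.
Proof.
move=> k1 t0 le_wt nkt H zero two total.
apply: (weight_array_contra k1 t0 nkt H zero) => [q r0 lt_qk|].
  apply: leq_trans (two q r0 lt_qk) _.
  by rewrite -(subnKC le_wt) iotaD count_cat leq_addr.
by apply: leq_trans total; apply: leq_sum => q _; apply: sum_nth_count.
Qed.

(** A checkerboard with five ones, the limit [2 k + 1] for [k = 2]. *)
Lemma two_rows_contra n t :
  4 < t -> n = 2 * t -> duality_bounds (windows n t) -> False.
Proof.
move=> t5 nt H.
apply: (@array_contra [:: [:: true; false; true; false; true];
                          [:: false; true; false; true; false]] [::] 5 _ _ _ _
                      _ t5 nt H) => //; first lia.
- move=> r _; case: r => [|[|[|[|[|r]]]]]; try by [exists 0|exists 1].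
  by exists 0; rewrite /array /= ?nth_nil.
- by move=> [|[|q]] // [|[|[|[|[|r0]]]]].
by rewrite unlock.
Qed.

Lemma three_rows_contra n t :
  3 < t -> n = 3 * t -> duality_bounds (windows n t) -> False.
Proof.
move=> t4 nt H.
apply: (@array_contra [:: [:: false; true; true; false];
                          [:: true; false; true; true];
                          [:: false; true; false; true]] [::] 4 _ _ _ _
                      _ t4 nt H) => //; first lia.
- move=> r _; case: r => [|[|[|[|r]]]]; try by [exists 0|exists 1|exists 2].
  by exists 0; rewrite /array /= ?nth_nil.
- by move=> [|[|[|q]]] // [|[|[|[|r0]]]].
by rewrite unlock.
Qed.

(** Every row has two ones except [111], for a total of [2 k + 1]. That row separates [110] from
    [011], whose direct succession would leave a window with a single one. The rows after the fourth
    repeat [011]. *)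
Lemma many_rows_contra n k t :
  2 < t -> 3 < k -> n = k * t -> duality_bounds (windows n t) -> False.
Proof.
move=> t3 k4 nt H.
pose d := [:: false; true; true].
pose rows := [:: d; [:: true; false; true]; [:: true; true; false];
                 [:: true; true; true]].
apply: (@array_contra rows d 3 _ _ _ _ _ t3 nt H); try lia.
- move=> r _; case: r => [|[|[|r]]];
    [exists 0 | exists 1 | exists 2 | exists 0]; rewrite ?/array //=; try lia.
  by rewrite ?nth_nil.
- move=> q r0 lt_qk.
  (* the row after the last one is row 0, which equals the default row d *)
  have next r : array rows d (window_row k q r0 r) r =
      array rows d (if r0 <= r then q else q.+1) r.
    rewrite /window_row; case: ifP => // _; case: ltnP => // le_kq.
    by case: q le_kq {lt_qk} => [|[|[|[|q]]]]; try lia.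
  rewrite (eq_count next).
  by case: q {lt_qk next} => [|[|[|[|q]]]]; case: r0 => [|[|[|r0]]] //;
    rewrite /array /= !nth_nil.
have [k' ->] : exists k', k = k'.+4 by exists (k - 4); lia.
rewrite !big_nat_recl //= (eq_bigr (fun=> 2)) => [|q _]; last by rewrite nth_nil.
by rewrite sum_nat_const_nat; lia.
Qed.

(** Here [k = n / t] is at least 2. Two rows leave only [t = 3] and [t = 4], three rows only
    [t = 3], and more rows nothing. *)
Lemma duality_bounds_windows n t : 3 <= t < n ->
  duality_bounds (windows n t) -> (t, n) \in [:: (3, 6); (3, 9); (4, 8)].
Proof.
move=> /andP[t3 lt_tn] H; have t0 : 0 < t by lia.
have /dvdnP[k nkt] := windows_dvdn t0 lt_tn H.
case: k nkt => [|[|[|[|k]]]] nkt; try lia.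
- have [t5|] := ltnP 4 t; first by case: (two_rows_contra t5 nkt H).
  by case: t t3 {t0 lt_tn H} nkt => [|[|[|[|[|t]]]]] // _ ->.
- have [t4|] := ltnP 3 t; first by case: (three_rows_contra t4 nkt H).
  by case: t t3 {t0 lt_tn H} nkt => [|[|[|[|t]]]] // _ ->.
by case: (many_rows_contra t3 _ nkt H).
Qed.

(* For t = 2 the equivalence fails: for the star K_{1,3}, and for C_4, the
   equality of optimal values holds for every alpha. *)
Theorem theorem3p9 (n t : nat) (e : rel 'I_n)
    (e_sym : symmetric e) (e_irr : irreflexive e)
    (e_conn : connected_graph e) (t_ge3 : (3 <= t)%N) :
  ((forall alpha : 'cV[nat]_n,
      tau_eq_nu (min_solutions_mx (tconn_mx e t)) alpha)
   <->
   ((t <= n)%N /\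
      eq_up_to_relabelling (tconn_mx e t) (tconn_mx (@path_graph n) t))
   \/
   ((t = n \/ (t, n) \in [:: (3, 6); (3, 9); (4, 8)]) /\
      eq_up_to_relabelling (tconn_mx e t) (tconn_mx (@cycle_graph n) t)))
  /\
  ((t <= n)%N ->
     eq_up_to_columns (tconn_mx (@path_graph n) t) (path_mx t n))
  /\
  ((t <= n)%N ->
     eq_up_to_columns (tconn_mx (@cycle_graph n) t) (cycle_mx t n)).
Proof.
split; last first.
  by split=> le_tn; [apply: path_columns | apply: cycle_columns]; lia.
pose E := connected_tsets e t.
(* Both sufficiency cases reduce to packings for the family of the standard graph. *)
have packs_relabel r (E' : {set {set 'I_n}}) (alpha : 'cV[nat]_n) :
    E' = relabel r E -> E' != set0 ->
    (forall a v, (forall S, S \in E' -> v <= \sum_(i in S) a i) ->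
       packs E' a v) ->
    tau_eq_nu (min_solutions_mx (tconn_mx e t)) alpha.
  move=> EE' E'0 hp; apply: (@tau_eq_nu_packs _ E).
    by apply: contra_neq E'0 => E0; rewrite EE' E0 /relabel imset0.
  move=> v hv; apply: (@packs_perm _ r _ E').
    by move=> S SE; rewrite EE' imset_f.
  apply: hp => S; rewrite EE' => /imsetP[S' S'E ->].
  by rewrite sum_preimset; under eq_bigr do rewrite permKV; apply: hv.
split=> [hB|]; last first.
  case=> -[tn /incidence_relabelling[r EE']] alpha.
    have htn : 0 < t <= n by lia.
    apply: (packs_relabel r _ alpha EE'); rewrite connected_tsets_path //.
      by apply/set0Pn; exists (segment n t 0); apply/imsetP; exists ord0.
    move=> a v hv; apply: packs_intervals => S SE; have := hv S SE.
    case/imsetP: SE => j _ -> le_v; exists j, (j + t); split=> [i|].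
      by rewrite inE.
    by apply: (leq_trans le_v); apply/eq_leq/eq_bigl => i; rewrite inE.
  have htn : 0 < t <= n.
    by case: tn => [<-|]; [lia|rewrite !inE; case/or3P=> /eqP[-> ->]].
  apply: (packs_relabel r _ alpha EE'); rewrite connected_tsets_cycle //.
    have n0 : 0 < n by lia.
    by apply/set0Pn; exists (window n t (Ordinal n0)); apply: imset_f.
  move=> a v hv; case: tn => [tn|tn]; last first.
    by apply: packs_windows_exceptional => // s; apply/hv/imset_f.
  (* For [t = n] a window is the whole vertex set, the interval from 0 to [n]. *)
  apply: packs_intervals => S SE; have := hv S SE.
  case/imsetP: SE => s _ -> le_v; exists 0, n; split=> [i _|].
    by rewrite inE tn ltn_pmod //; lia.
  apply: (leq_trans le_v); rewrite [X in X <= _]big_mkcond [X in _ <= X]big_mkcond.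
  by apply: leq_sum => i _; rewrite /= ltn_ord; case: ifP.
(* A feasible solution of the covering program exhibits a connected [t]-set, whence [t <= n]. *)
have [S] : exists S, S \in E.
  by case: (hB (ones n)) => v [[y /tau_feasibleP[S SE _] _] _]; exists S.
rewrite inE => /andP[/eqP St _].
have le_tn : t <= n by rewrite -St -[X in _ <= X]card_ord max_card.
have [tn|lt_tn] : t = n \/ t < n by lia.
  (* For [t = n] the vertex set is the only connected [t]-set, so the matrix is already that of the
     path. *)
  have tsetsT (e' : rel 'I_n) : connected_graph e' ->
      connected_tsets e' t = [set setT].
    move=> e'_conn; apply/setP => U; rewrite !inE; apply/andP/eqP => [[/eqP Ut _]|->].
      by apply/eqP; rewrite eqEcard subsetT cardsT card_ord Ut tn leqnn.
    by rewrite cardsT card_ord tn eqxx.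
  left; split=> //; apply: (@eq_up_to_relabelling_incidence _ _ _ 1%g).
  rewrite !tsetsT //.
    by rewrite /relabel imset_set1; congr [set _]; apply/setP => i; rewrite !inE.
  have := @path_graph_sym n.
  rewrite /connected_graph => psym.
  have := range_connected psym (@ord_inj n) (lo := 0) (hi := n).
  have -> : [set i : 'I_n | 0 <= i < n] = setT by apply/setP => i; rewrite !inE ltn_ord.
  apply; first by move=> u v; rewrite /path_graph /=; lia.
  exact: ord_exists.
have deg2 c a b d := @degree_le2 n e e_sym e_irr e_conn t c a b d _ hB.
have n0 : 0 < n by lia.
have [|r [re|re]] := degree_le2_path_or_cycle e_sym e_irr e_conn n0.
- by move=> c a b d; apply: deg2; lia.
- left; split=> //; apply: (@eq_up_to_relabelling_incidence _ _ _ r).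
  exact: connected_tsets_relabel.
have EE' := connected_tsets_relabel t re.
right; split; last exact: eq_up_to_relabelling_incidence EE'.
right; apply: duality_bounds_windows; first lia.
rewrite -connected_tsets_cycle ?EE'; last by lia.
exact: duality_bounds_relabel.
Qed.
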